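(* Let $n,m,r$ be positive integers with $n$ and $m$ coprime. If $r$ is coprime with $n$ and with $m$, then $$[\mathcal R^{irr}(\mathrm{GL}_r)]=\frac{q-1}{r}\,[\mathcal R^{irr}(\mathrm{SL}_r)]$$ in $K_0(\mathrm{Var}_{\mathbb C})\otimes\mathbb Q$, where $q$ is the class of the affine line.
   Context: $K_0(\mathrm{Var}_{\mathbb C})$ is the Grothendieck ring of complex varieties. Let $\Gamma_{n,m}=\langle x,y\mid x^n=y^m\rangle$ be the fundamental group of the $(n,m)$ torus knot. For $G=\mathrm{GL}_r$ or $\mathrm{SL}_r$, the representation variety is $\mathcal R(G)=\operatorname{Hom}(\Gamma_{n,m},G(\mathbb C))=\{(A,B)\in G(\mathbb C)^2: A^n=B^m\}$, and $\mathcal R^{irr}(G)\subset\mathcal R(G)$ is the subvariety of pairs $(A,B)$ whose associated representation on $\mathbb C^r$ is irreducible. *)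

(* Defs.v *)
From HB Require Import structures.
From mathcomp Require Import all_boot all_order all_algebra.
From mathcomp Require Import boolp classical_sets reals.
From mathcomp Require Import complex.
From mathcomp Require Import mpoly.
Set Implicit Arguments.
Unset Strict Implicit.
Unset Printing Implicit Defensive.
Import GRing.Theory.
Local Open Scope ring_scope.
Local Open Scope classical_set_scope.
Local Open Scope quotient_scope.

(* presented_ring rel is the commutative ring with generators X and relations
   rel: formal ring expressions modulo the smallest congruence containing rel
   and the axioms of commutative rings (it is allowed to be trivial). *)
Inductive ring_expr (X : Type) :=
| RGen of X
| RZero
| ROne
| RAdd of ring_expr X & ring_expr X
| ROpp of ring_expr X
| RMul of ring_expr X & ring_expr X.
Arguments RZero {X}.
Arguments ROne {X}.

Inductive ring_eq (X : Type) (rel : ring_expr X -> ring_expr X -> Prop) :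
  ring_expr X -> ring_expr X -> Prop :=
| req_rel a b : rel a b -> ring_eq rel a b
| req_refl a : ring_eq rel a a
| req_sym a b : ring_eq rel a b -> ring_eq rel b a
| req_trans a b c : ring_eq rel a b -> ring_eq rel b c -> ring_eq rel a c
| req_add a a' b b' : ring_eq rel a a' -> ring_eq rel b b' ->
    ring_eq rel (RAdd a b) (RAdd a' b')
| req_opp a a' : ring_eq rel a a' -> ring_eq rel (ROpp a) (ROpp a')
| req_mul a a' b b' : ring_eq rel a a' -> ring_eq rel b b' ->
    ring_eq rel (RMul a b) (RMul a' b')
| req_addA a b c : ring_eq rel (RAdd a (RAdd b c)) (RAdd (RAdd a b) c)
| req_addC a b : ring_eq rel (RAdd a b) (RAdd b a)
| req_add0 a : ring_eq rel (RAdd RZero a) a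
| req_addN a : ring_eq rel (RAdd (ROpp a) a) RZero
| req_mulA a b c : ring_eq rel (RMul a (RMul b c)) (RMul (RMul a b) c)
| req_mulC a b : ring_eq rel (RMul a b) (RMul b a)
| req_mul1 a : ring_eq rel (RMul ROne a) a
| req_mulD a b c :
    ring_eq rel (RMul (RAdd a b) c) (RAdd (RMul a c) (RMul b c)).

HB.instance Definition _ (X : Type) := gen_eqMixin (ring_expr X).
HB.instance Definition _ (X : Type) := gen_choiceMixin (ring_expr X).

Section PresentedRing.
Variables (X : Type) (rel : ring_expr X -> ring_expr X -> Prop).

Definition ring_eqb (a b : ring_expr X) : bool := `[< ring_eq rel a b >].

Lemma ring_eqb_equiv : equiv_class_of ring_eqb.
Proof.
split=> [a | a b | b a c].
- exact/asboolP/req_refl.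
- by apply/asboolP/asboolP => h; apply: req_sym.
- by move=> /asboolP h1 /asboolP h2; apply/asboolP/(req_trans h1).
Qed.

Canonical ring_eqb_rel := EquivRelPack ring_eqb_equiv.

Definition presented_ring := {eq_quot ring_eqb_rel}%qT.
HB.instance Definition _ := Choice.on presented_ring.
HB.instance Definition _ := EqQuotient.on presented_ring.

Definition pclass (a : ring_expr X) : presented_ring := \pi_(presented_ring) a.

Lemma pclassP a b : pclass a = pclass b <-> ring_eq rel a b.
Proof.
rewrite /pclass; split=> [/eqquotP/asboolP // | h].
by apply/eqquotP/asboolP.
Qed.

Lemma pclass_repr (x : presented_ring) : pclass (repr x) = x.
Proof. exact: reprK. Qed.

Lemma repr_pclass a : ring_eq rel (repr (pclass a)) a.
Proof. by apply/pclassP; rewrite pclass_repr. Qed.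

Definition padd (x y : presented_ring) := pclass (RAdd (repr x) (repr y)).
Definition popp (x : presented_ring) := pclass (ROpp (repr x)).
Definition pmul (x y : presented_ring) := pclass (RMul (repr x) (repr y)).

Lemma paddE a b : padd (pclass a) (pclass b) = pclass (RAdd a b).
Proof. by apply/pclassP/req_add; apply: repr_pclass. Qed.

Lemma poppE a : popp (pclass a) = pclass (ROpp a).
Proof. by apply/pclassP/req_opp; apply: repr_pclass. Qed.

Lemma pmulE a b : pmul (pclass a) (pclass b) = pclass (RMul a b).
Proof. by apply/pclassP/req_mul; apply: repr_pclass. Qed.

Lemma paddA : associative padd.
Proof.
move=> x y z; rewrite -(pclass_repr x) -(pclass_repr y) -(pclass_repr z).
by rewrite !paddE; apply/pclassP/req_addA.
Qed.

Lemma paddC : commutative padd.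
Proof. by move=> x y; apply/pclassP/req_addC. Qed.

Lemma padd0 : left_id (pclass RZero) padd.
Proof.
by move=> x; rewrite -(pclass_repr x) paddE; apply/pclassP/req_add0.
Qed.

Lemma paddN : left_inverse (pclass RZero) popp padd.
Proof.
by move=> x; rewrite -(pclass_repr x) poppE paddE; apply/pclassP/req_addN.
Qed.

HB.instance Definition _ :=
  GRing.isZmodule.Build presented_ring paddA paddC padd0 paddN.

Lemma pmulA : associative pmul.
Proof.
move=> x y z; rewrite -(pclass_repr x) -(pclass_repr y) -(pclass_repr z).
by rewrite !pmulE; apply/pclassP/req_mulA.
Qed.

Lemma pmulC : commutative pmul.
Proof. by move=> x y; apply/pclassP/req_mulC. Qed.

Lemma pmul1 : left_id (pclass ROne) pmul.
Proof.
by move=> x; rewrite -(pclass_repr x) pmulE; apply/pclassP/req_mul1.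
Qed.

Lemma pmulDl : left_distributive pmul +%R.
Proof.
move=> x y z; rewrite -[x + y]/(padd x y) -[RHS]/(padd _ _).
rewrite -(pclass_repr x) -(pclass_repr y) -(pclass_repr z).
by rewrite !(pmulE, paddE); apply/pclassP/req_mulD.
Qed.

HB.instance Definition _ :=
  GRing.Zmodule_isComPzRing.Build presented_ring pmulA pmulC pmul1 pmulDl.

Definition gen (x : X) : presented_ring := pclass (RGen x).

End PresentedRing.

(* The tensor product over Z of two commutative rings, presented by the pure
   tensors tens a b. As a product of pure tensors is a pure tensor, its additive
   group is the tensor product of the additive groups. *)
Section Tensor.
Variables A B : comPzRingType.

Inductive tensor_rel : ring_expr (A * B) -> ring_expr (A * B) -> Prop :=
| tensor_addl a a' b :
    tensor_rel (RGen (a + a', b)) (RAdd (RGen (a, b)) (RGen (a', b)))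
| tensor_addr a b b' :
    tensor_rel (RGen (a, b + b')) (RAdd (RGen (a, b)) (RGen (a, b')))
| tensor_mul a a' b b' :
    tensor_rel (RMul (RGen (a, b)) (RGen (a', b'))) (RGen (a * a', b * b'))
| tensor_one : tensor_rel (RGen (1, 1)) ROne.

Definition tensor := presented_ring tensor_rel.
HB.instance Definition _ := GRing.ComPzRing.on tensor.

Definition tens (a : A) (b : B) : tensor := gen tensor_rel (a, b).
End Tensor.

Section Varieties.
Variable k : closedFieldType.

(* Varieties are spaces with functions in the sense of Serre: a set of points
   with a topology and a sheaf of k-valued functions, locally isomorphic to
   Zariski-closed subsets of affine spaces, and separated. The points of a space
   are taken in the fixed set seq k of finite sequences, in which the points of
   affine n-space are the sequences of size n. This is no loss of generality:
   a variety has at most as many points as seq k, so every variety is isomorphic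
   to one of these, and isomorphism classes are the same. *)
Definition vpoint := seq k.

Definition eq_on (V : set vpoint) (T : Type) (f g : vpoint -> T) : Prop :=
  forall x, V x -> f x = g x.

(* opens X V: V is open in X; regular X V f: f restricts to a section over V.
   Functions are total on vpoint k, but only their values on V matter, by
   regular_ext below. *)
Record space := Space {
  carrier :> set vpoint;
  opens : set (set vpoint);
  regular : set vpoint -> set (vpoint -> k)
}.

Record is_space (X : space) : Prop := IsSpace {
  open_sub : forall V, opens X V -> V `<=` X;
  open_full : opens X X;
  open_setI : forall V W, opens X V -> opens X W -> opens X (V `&` W);
  open_bigcup : forall F : set (set vpoint), F `<=` opens X ->
    opens X (\bigcup_(V in F) V);
  regular_open : forall V f, regular X V f -> opens X V;
  regular_ext : forall V f g, regular X V f -> eq_on V f g ->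
    regular X V g;
  regular_cst : forall V c, opens X V -> regular X V (fun=> c);
  regularD : forall V f g, regular X V f -> regular X V g ->
    regular X V (fun x => f x + g x);
  regularM : forall V f g, regular X V f -> regular X V g ->
    regular X V (fun x => f x * g x);
  regular_res : forall V W f, regular X V f -> opens X W -> W `<=` V ->
    regular X W f;
  regular_glue : forall V f, opens X V ->
    (forall x, V x -> exists W, [/\ regular X W f, W x & W `<=` V]) ->
    regular X V f
}.

Definition is_closed (X : space) (S : set vpoint) : Prop :=
  S `<=` X /\ opens X (X `\` S).

(* The structure induced on an arbitrary subset S of X: the subspace topology,
   and functions that are locally restrictions of regular functions on X. For S
   open these are the functions regular on X; for S closed, this is the reduced
   closed subvariety. *)
Definition restrict (X : space) (S : set vpoint) : space :=
  let op := [set V | exists2 W, opens X W & V = W `&` S] in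
  Space (X `&` S) op
    (fun V => [set f | op V /\ forall x, V x ->
       exists W g, [/\ regular X W g, W x & eq_on (V `&` W) f g]]).

Record is_morphism (X Y : space) (f : vpoint -> vpoint) : Prop := IsMorphism {
  mor_sub : forall x, carrier X x -> carrier Y (f x);
  mor_open : forall V, opens Y V -> opens X (X `&` f @^-1` V);
  mor_regular : forall V g, regular Y V g ->
    regular X (X `&` f @^-1` V) (g \o f)
}.

Definition isomorphic (X Y : space) : Prop := exists f g,
  [/\ is_morphism X Y f, is_morphism Y X g,
      eq_on X (g \o f) id & eq_on Y (f \o g) id].

Definition peval n (p : {mpoly k[n]}) (x : vpoint) : k :=
  p.@[fun i : 'I_n => x`_i].

Definition zeros n (P : set {mpoly k[n]}) : set vpoint :=
  [set x | size x = n /\ forall p, P p -> peval p x = 0].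

Definition affine_space (n : nat) : space :=
  let An := [set x : vpoint | size x = n] in
  let op := [set V | exists P : set {mpoly k[n]}, V = An `\` zeros P] in
  Space An op
    (fun V => [set f | op V /\ forall x, V x ->
       exists W (a b : {mpoly k[n]}), [/\ op W, W x, W `<=` V &
         forall y, W y -> peval b y != 0 /\ f y = peval a y / peval b y]]).

Definition is_affine (X : space) : Prop :=
  is_space X /\ exists n (P : set {mpoly k[n]}),
    isomorphic X (restrict (affine_space n) (zeros P)).

(* Separatedness: two morphisms from an affine variety agree on a closed set. *)
Definition is_separated (X : space) : Prop :=
  forall Z f g, is_affine Z -> is_morphism Z X f -> is_morphism Z X g ->
    is_closed Z (Z `&` [set z | f z = g z]).

Definition has_affine_cover (X : space) : Prop :=
  exists N (U : 'I_N -> set vpoint),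
    (forall i, opens X (U i) /\ is_affine (restrict X (U i))) /\
    (X : set vpoint) = \bigcup_i U i.

Definition is_variety (X : space) : Prop :=
  [/\ is_space X, has_affine_cover X & is_separated X].

Record variety := Variety {
  variety_space :> space;
  varietyP : is_variety variety_space
}.

(* P is a product of X and Y in the category of varieties. *)
Definition is_product (P X Y : variety) : Prop := exists p1 p2,
  [/\ is_morphism P X p1, is_morphism P Y p2 &
   forall (Z : variety) f g, is_morphism Z X f -> is_morphism Z Y g ->
     (exists h, [/\ is_morphism Z P h, eq_on Z (p1 \o h) f &
                    eq_on Z (p2 \o h) g]) /\
     (forall h h', is_morphism Z P h -> is_morphism Z P h' ->
        eq_on Z (p1 \o h) (p1 \o h') -> eq_on Z (p2 \o h) (p2 \o h') ->
        eq_on Z h h')].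

(* The Grothendieck ring of varieties: isomorphism classes, [X] = [S] + [X \ S]
   for S closed in X, and [X x Y] = [X][Y] with unit the class of a point.
   By the product relation, every element of this ring is a Z-combination of
   classes of varieties, so this is the usual quotient of the free abelian group
   on isomorphism classes by the scissor relations, with the product of
   varieties as multiplication. *)
Inductive K0_rel : ring_expr variety -> ring_expr variety -> Prop :=
| K0_iso (X Y : variety) : isomorphic X Y -> K0_rel (RGen X) (RGen Y)
| K0_scissor (X Z U : variety) (S : set vpoint) :
    is_closed X S -> isomorphic Z (restrict X S) ->
    isomorphic U (restrict X (X `\` S)) ->
    K0_rel (RGen X) (RAdd (RGen Z) (RGen U))
| K0_product (P X Y : variety) : is_product P X Y ->
    K0_rel (RGen P) (RMul (RGen X) (RGen Y))
| K0_point (X : variety) : isomorphic X (affine_space 0) -> K0_rel (RGen X) ROne.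

Definition K0 := presented_ring K0_rel.
HB.instance Definition _ := GRing.ComPzRing.on K0.

Definition K0_class (X : variety) : K0 := gen K0_rel X.

(* A pair (A, B) of r x r matrices is encoded as a point of affine 2r^2-space:
   the entries of A row by row, then those of B. *)
Definition coord_mx (r off : nat) (s : vpoint) : 'M[k]_r :=
  \matrix_(i < r, j < r) s`_(off + (i * r + j)).

(* The representation of <x, y | x^n = y^m> on column vectors with x |-> A and
   y |-> B. A subspace of k^r is the set of transposes of the vectors in the row
   space of W, hence the transposes g^T; it is a subrepresentation iff it is
   stable under the generators and their inverses. *)
Definition irreducible_rep (r : nat) (A B : 'M[k]_r) : Prop :=
  (0 < r)%N /\ forall W : 'M[k]_r,
    {in [:: A; B; invmx A; invmx B], forall g, stablemx W g^T} ->
    W = 0 \/ row_full W.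

Variant group_kind := GL | SL.

Definition in_group (G : group_kind) (r : nat) (A : 'M[k]_r) : Prop :=
  match G with
  | GL => A \in unitmx
  | SL => \det A = 1
  end.

Definition rep_set (G : group_kind) (n m r : nat) : set vpoint :=
  [set s | size s = (r * r + r * r)%N /\
    let A := coord_mx r 0 s in let B := coord_mx r (r * r) s in
    [/\ in_group G A, in_group G B & A ^+ n = B ^+ m]].

Definition irr_rep_set (G : group_kind) (n m r : nat) : set vpoint :=
  rep_set G n m r `&`
  [set s | irreducible_rep (coord_mx r 0 s) (coord_mx r (r * r) s)].

End Varieties.

(* The rest of the file shows that affine spaces and the sets irr_rep_set are
   varieties. Irreducibility is an open condition by Burnside's theorem: for
   r > 0, (A, B) is irreducible iff words in A and B span the r x r matrices, and
   words of length at most r^2 suffice. *)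
Section VarietyTheory.
Variable k : closedFieldType.
Implicit Types (X Y : space k) (V W S T : set (vpoint k)).

Lemma open_local X V : is_space X ->
  (forall x, V x -> exists W, [/\ opens X W, W x & W `<=` V]) -> opens X V.
Proof.
move=> sX h.
have -> : V = \bigcup_(W in [set W | opens X W /\ W `<=` V]) W.
  apply/seteqP; split=> [x /h [W [oW Wx sW]]|x [W [_ sW] /sW //]].
  by exists W.
by apply: (open_bigcup sX) => W [].
Qed.

Definition has_inverses X := forall V f, regular X V f ->
  regular X (V `&` [set x | f x != 0]) (fun x => (f x)^-1).

Lemma peval_cst n c x : peval (c%:MP : {mpoly k[n]}) x = c.
Proof. exact: mevalC. Qed.

Lemma pevalD n (p q : {mpoly k[n]}) x : peval (p + q) x = peval p x + peval q x.
Proof. exact: mevalD. Qed.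

Lemma pevalM n (p q : {mpoly k[n]}) x : peval (p * q) x = peval p x * peval q x.
Proof. exact: mevalM. Qed.

Lemma pevalB n (p q : {mpoly k[n]}) x : peval (p - q) x = peval p x - peval q x.
Proof. exact: mevalB. Qed.

Lemma pevalX n (i : 'I_n) x : peval ('X_i : {mpoly k[n]}) x = x`_i.
Proof. exact: mevalXU. Qed.

Lemma open_affineP n V : opens (affine_space k n) V <->
  (forall x, V x -> size x = n) /\
  forall x, V x -> exists2 p : {mpoly k[n]}, peval p x != 0 &
    forall y, size y = n -> peval p y != 0 -> V y.
Proof.
split=> [[P ->]|[sV h]].
  split=> [x []//|x [/= sx nPx]].
  have [p Pp px] : exists2 p, P p & peval p x != 0.
    apply: contrapT => hn; apply: nPx; split=> // p Pp.
    by apply: contrapT => /eqP px; apply: hn; exists p.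
  exists p => // y sy py; split=> // -[_ /(_ _ Pp) /eqP].
  by rewrite (negbTE py).
exists [set p | forall y, size y = n -> peval p y != 0 -> V y].
apply/seteqP; split=> [x Vx|x [/= sx nZ]].
  split; first exact: sV.
  have [p px hp] := h _ Vx.
  by move=> [_ /(_ p hp) /eqP]; rewrite (negbTE px).
apply: contrapT => nVx; apply: nZ; split=> // p hp.
by apply: contrapT => /eqP px; apply: nVx; apply: hp.
Qed.

Lemma regular_affineP n V f : regular (affine_space k n) V f <->
  opens (affine_space k n) V /\
  forall x, V x -> exists a b : {mpoly k[n]}, peval b x != 0 /\
    forall y, size y = n -> peval b y != 0 -> V y /\ f y = peval a y / peval b y.
Proof.
split=> -[oV h]; split=> // x Vx; have := h x Vx.
  move=> [W [a [b [/open_affineP[_ oW] Wx sW hab]]]].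
  have [p px hp] := oW _ Wx; have [bx _] := hab _ Wx.
  exists (a * p), (b * p); rewrite pevalM mulf_neq0//; split=> // y sy.
  rewrite !pevalM mulf_eq0 negb_or => /andP[_ py].
  have [by_ ->] := hab y (hp _ sy py).
  split; first exact/sW/hp.
  by rewrite -mulf_div divff// mulr1.
have [sV _] := (open_affineP n V).1 oV.
move=> [a [b [bx hab]]].
exists [set y | size y = n /\ peval b y != 0], a, b; split=> //.
- apply/open_affineP; split=> [y []//|y [sy py]]; exists b => //.
- by split=> //; apply: sV.
- by move=> y [sy py]; have [] := hab y sy py.
- by move=> y [sy py]; have [] := hab y sy py.
Qed.

Lemma affine_is_space n : is_space (affine_space k n).
Proof.
have dom V : opens (affine_space k n) V -> forall x, V x -> size x = n.
  by move=> /open_affineP[].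
split.
- by move=> V /open_affineP[sV _] x /sV.
- apply/open_affineP; split=> // x sx; exists 1%:MP => //.
  by rewrite peval_cst oner_neq0.
- move=> V W /open_affineP[sV hV] /open_affineP[_ hW]; apply/open_affineP.
  split=> [x [/sV]//|x [/hV[p px hp] /hW[q qx hq]]].
  exists (p * q) => [|y sy]; rewrite pevalM mulf_eq0 negb_or ?px//.
  by move=> /andP[py qy]; split; [exact: hp|exact: hq].
- move=> F hF; apply/open_affineP; split=> [x [V /hF /dom hV Vx]|x [V FV Vx]].
    exact: hV.
  have [_ /(_ _ Vx) [p px hp]] := (open_affineP n V).1 (hF _ FV).
  by exists p => // y sy py; exists V => //; apply: hp.
- by move=> V f [].
- move=> V f g /regular_affineP[oV h] fg; apply/regular_affineP; split=> // x.
  move=> /h[a [b [bx hab]]]; exists a, b; split=> // y sy py.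
  by have [Vy <-] := hab y sy py; rewrite fg.
- move=> V c oV; apply/regular_affineP; split=> // x.
  have [_ /[apply] -[p px hp]] := (open_affineP n V).1 oV.
  exists (c%:MP * p), p; split=> // y sy py; split; first exact: hp.
  by rewrite pevalM peval_cst mulfK.
- move=> V f g /regular_affineP[oV hf] /regular_affineP[_ hg].
  apply/regular_affineP; split=> // x Vx.
  have [a [b [bx hab]]] := hf _ Vx; have [c [d [dx hcd]]] := hg _ Vx.
  exists (a * d + c * b), (b * d).
  split=> [|y sy]; first by rewrite pevalM mulf_neq0.
  rewrite !(pevalD, pevalM) mulf_eq0 negb_or => /andP[py qy].
  have [Vy ->] := hab y sy py; have [_ ->] := hcd y sy qy.
  by split=> //; rewrite addf_div.
- move=> V f g /regular_affineP[oV hf] /regular_affineP[_ hg].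
  apply/regular_affineP; split=> // x Vx.
  have [a [b [bx hab]]] := hf _ Vx; have [c [d [dx hcd]]] := hg _ Vx.
  exists (a * c), (b * d).
  split=> [|y sy]; first by rewrite pevalM mulf_neq0.
  rewrite !pevalM mulf_eq0 negb_or => /andP[py qy].
  have [Vy ->] := hab y sy py; have [_ ->] := hcd y sy qy.
  by split=> //; rewrite mulf_div.
- move=> V W f /regular_affineP[_ hf] oW sW; apply/regular_affineP; split=> // x Wx.
  have [a [b [bx hab]]] := hf _ (sW _ Wx).
  have [_ /(_ _ Wx) [p px hp]] := (open_affineP n W).1 oW.
  exists (a * p), (b * p); split=> [|y sy]; first by rewrite pevalM mulf_neq0.
  rewrite !pevalM mulf_eq0 negb_or => /andP[py qy]; split; first exact: hp.
  by have [_ ->] := hab y sy py; rewrite -mulf_div divff// mulr1.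
- move=> V f oV h; apply/regular_affineP; split=> // x /h[W [rW Wx sW]].
  have [_ /(_ _ Wx) [a [b [bx hab]]]] := (regular_affineP n W f).1 rW.
  exists a, b; split=> // y sy py; have [Wy ->] := hab y sy py.
  by split=> //; apply: sW.
Qed.

Lemma affine_has_inverses n : has_inverses (affine_space k n).
Proof.
move=> V f /regular_affineP[oV hf]; have [sV _] := (open_affineP n V).1 oV.
have key x : V x -> f x != 0 -> exists a b : {mpoly k[n]}, peval b x != 0 /\
    forall y, size y = n -> peval b y != 0 ->
      (V y /\ f y != 0) /\ (f y)^-1 = peval a y / peval b y.
  move=> Vx fx; have [a [b [bx hab]]] := hf _ Vx.
  have [_ fE] := hab x (sV _ Vx) bx.
  have ax : peval a x != 0.
    by apply: contraNneq fx => a0; rewrite fE a0 mul0r.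
  exists (b * b), (a * b); split=> [|y sy]; first by rewrite pevalM mulf_neq0.
  rewrite !pevalM mulf_eq0 negb_or => /andP[py qy]; have [Vy ->] := hab y sy qy.
  rewrite mulf_neq0 ?invr_neq0//; split=> //.
  by rewrite invf_div -mulf_div divff// mulr1.
apply/regular_affineP; split.
  apply/open_affineP; split=> [x [/sV]//|x [Vx fx]].
  have [a [b [bx hab]]] := key x Vx fx; exists b => // y sy py.
  by have [] := hab y sy py.
by move=> x [Vx fx]; apply: key.
Qed.

Lemma regular_coord n (i : 'I_n) :
  regular (affine_space k n) (affine_space k n) (fun x => x`_i).
Proof.
have sA := affine_is_space n.
apply/regular_affineP; split; first exact: (open_full sA).
move=> x sx; exists 'X_i, 1%:MP; rewrite peval_cst oner_neq0; split=> // y sy _.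
by split=> //; rewrite peval_cst pevalX divr1.
Qed.

Lemma restrict_is_space X S : is_space X -> is_space (restrict X S).
Proof.
move=> sX; have opI V W : opens (restrict X S) V -> opens (restrict X S) W ->
    opens (restrict X S) (V `&` W).
  move=> [V' oV ->] [W' oW ->]; exists (V' `&` W'); first exact: (open_setI sX).
  by rewrite -setIIl.
have subS V x : opens (restrict X S) V -> V x -> S x by move=> [W _ ->] [].
split=> //.
- by move=> V [W /(open_sub sX) sW ->]; apply: setSI.
- by exists X => //; apply: (open_full sX).
- move=> F hF; exists (\bigcup_(W in [set W | opens X W /\ F (W `&` S)]) W).
    by apply: (open_bigcup sX) => W [].
  apply/seteqP; split=> [x [V FV Vx]|x [[W [oW FW] Wx] Sx]].
    have [W oW VE] := hF _ FV; move: FV Vx; rewrite VE => FV [Wx Sx].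
    by split=> //; exists W.
  by exists (W `&` S).
- by move=> V f [].
- move=> V f g [oV h] fg; split=> // x /h[W [u [rW Wx fu]]].
  by exists W, u; split=> // y [Vy Wy]; rewrite -fg ?fu.
- move=> V c oV; split=> // x Vx; exists X, (fun=> c); split=> //.
    exact/(regular_cst sX)/(open_full sX).
  by case: oV Vx => W /(open_sub sX) sW -> [/sW].
- move=> V f g [oV hf] [_ hg]; split=> // x Vx.
  have [W [u [rW Wx fu]]] := hf x Vx; have [W' [u' [rW' Wx' fu']]] := hg x Vx.
  have oI : opens X (W `&` W').
    by apply: (open_setI sX); apply: (regular_open sX); [exact: rW|exact: rW'].
  exists (W `&` W'), (fun x => u x + u' x); split=> //.
    by apply: (regularD sX); [apply: (regular_res sX rW)|apply: (regular_res sX rW')] => // y [].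
  by move=> y [Vy [Wy Wy']]; rewrite fu// fu'.
- move=> V f g [oV hf] [_ hg]; split=> // x Vx.
  have [W [u [rW Wx fu]]] := hf x Vx; have [W' [u' [rW' Wx' fu']]] := hg x Vx.
  have oI : opens X (W `&` W').
    by apply: (open_setI sX); apply: (regular_open sX); [exact: rW|exact: rW'].
  exists (W `&` W'), (fun x => u x * u' x); split=> //.
    by apply: (regularM sX); [apply: (regular_res sX rW)|apply: (regular_res sX rW')] => // y [].
  by move=> y [Vy [Wy Wy']]; rewrite fu// fu'.
- move=> V W f [oV h] oW sW; split=> // x Wx.
  have [W' [u [rW Wx' fu]]] := h _ (sW _ Wx).
  by exists W', u; split=> // y [/sW Vy Wy]; apply: fu.
- move=> V f oV h; split=> // x Vx.
  have [W [[oW hW] Wx sW]] := h x Vx.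
  have [W' [u [rW' Wx' fu]]] := hW x Wx.
  have [W2 oW2 WE] := oW.
  exists (W2 `&` W'), u; split.
  + apply: (regular_res sX rW'); last by move=> y [].
    by apply: (open_setI sX) => //; apply: (regular_open sX rW').
  + by split=> //; move: Wx; rewrite WE => -[].
  + move=> y [Vy [Wy Wy']]; apply: fu; split=> //.
    by rewrite WE; split=> //; apply: (subS V).
Qed.

Lemma restrict_has_inverses X S : is_space X -> has_inverses X ->
  has_inverses (restrict X S).
Proof.
move=> sX iX V f rf; have sR := restrict_is_space S sX.
have [[V' oV' VE] h] := rf.
have key x : V x -> f x != 0 -> exists W u, [/\ regular X W u, W x,
    (forall y, W y -> S y -> V y) & forall y, W y -> S y -> f y != 0 /\ (f y)^-1 = u y].
  move=> Vx fx; have [W [u [rW Wx fu]]] := h x Vx.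
  have r' := iX _ _ rW.
  exists (V' `&` (W `&` [set x | u x != 0])), (fun y => (u y)^-1); split.
  - apply: (regular_res sX r'); last by move=> y [].
    by apply: (open_setI sX) => //; apply: (regular_open sX r').
  - split; first by move: Vx; rewrite VE => -[].
    by split=> //=; rewrite -fu.
  - by move=> y [Vy _] Sy; rewrite VE.
  - move=> y [Vy [Wy /= uy]] Sy; rewrite fu//; split=> //.
    by rewrite VE.
split.
  apply: (open_local sR) => x [Vx /= fx].
  have [W [u [rW Wx sW hW]]] := key x Vx fx.
  exists (W `&` S); split.
  - by exists W => //; apply: (regular_open sX rW).
  - by split=> //; move: Vx; rewrite VE => -[].
  - by move=> y [Wy Sy]; split; [exact: sW|have [] := hW y Wy Sy].
move=> x [Vx /= fx].
have [W [u [rW Wx sW hW]]] := key x Vx fx.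
exists W, u; split=> // y [[Vy _] Wy].
by have [] := hW y Wy; first by move: Vy; rewrite VE => -[].
Qed.

Lemma restrict_restrict X S T : is_space X ->
  restrict (restrict X S) T = restrict X (S `&` T).
Proof.
move=> sX; rewrite /restrict /=.
have opE V : (exists2 W, (exists2 W', opens X W' & W = W' `&` S) & V = W `&` T) =
    (exists2 W, opens X W & V = W `&` (S `&` T)).
  apply: propext; split=> [[W [W' oW ->] ->]|[W oW ->]].
    by exists W' => //; rewrite setIA.
  by exists (W `&` S); [exists W|rewrite setIA].
congr Space; first by rewrite setIA.
  by apply/funext => V; apply: opE.
apply/funext => V; apply/funext => f; apply: propext; rewrite /= opE.
split=> -[oV h]; split=> // x Vx.
  have [W [g [[oW hW] Wx fg]]] := h x Vx.
  have [W1 oW1 WE] := oW.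
  have [W' [u [rW' Wx' gu]]] := hW x Wx.
  exists (W1 `&` W'), u; split.
  - apply: (regular_res sX rW'); last by move=> y [].
    by apply: (open_setI sX) => //; apply: (regular_open sX rW').
  - by split=> //; move: Wx; rewrite WE => -[].
  - move=> y [Vy [W1y Wy']].
    have Wy : W y.
      rewrite WE; split=> //; move: Vy; case: oV => ? _ ->.
      by move=> [_ []].
    by rewrite fg// gu.
have [W [g [rW Wx fg]]] := h x Vx.
have Sx y : V y -> S y by case: oV => ? _ -> [_ []].
have oW : opens X W := regular_open sX rW.
exists (W `&` S), g; split.
- split; first by exists W.
  by move=> y [Wy Sy]; exists W, g; split.
- by split=> //; apply: Sx.
- by move=> y [Vy [Wy _]]; apply: fg.
Qed.

Lemma restrict_open_regular X S V f : is_space X -> opens X V -> S `<=` V ->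
  regular X V f -> regular (restrict X S) (restrict X S) f.
Proof.
move=> sX oV sV rf; split; first by exists X => //; apply: (open_full sX).
by move=> x [Xx /sV Vx]; exists V, f; split.
Qed.

Lemma regular_sum X (I : Type) (r : seq I) V (F : I -> vpoint k -> k) :
  is_space X -> opens X V -> (forall i, regular X V (F i)) ->
  regular X V (fun x => \sum_(i <- r) F i x).
Proof.
move=> sX oV h; elim: r => [|i r IH].
  by apply: (regular_ext sX (regular_cst sX 0 oV)) => x _; rewrite big_nil.
by apply: (regular_ext sX (regularD sX (h i) IH)) => x _; rewrite big_cons.
Qed.

Lemma regular_prod X (I : Type) (r : seq I) V (F : I -> vpoint k -> k) :
  is_space X -> opens X V -> (forall i, regular X V (F i)) ->
  regular X V (fun x => \prod_(i <- r) F i x).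
Proof.
move=> sX oV h; elim: r => [|i r IH].
  by apply: (regular_ext sX (regular_cst sX 1 oV)) => x _; rewrite big_nil.
by apply: (regular_ext sX (regularM sX (h i) IH)) => x _; rewrite big_cons.
Qed.

Lemma regularX X V (f : vpoint k -> k) e : is_space X ->
  regular X V f -> regular X V (fun x => f x ^+ e).
Proof.
move=> sX h; elim: e => [|e IH].
  by apply: (regular_ext sX (regular_cst sX 1 (regular_open sX h))) => x _; rewrite expr0.
by apply: (regular_ext sX (regularM sX h IH)) => x _; rewrite exprS.
Qed.

Lemma regular_peval X V n (phi : vpoint k -> vpoint k) (p : {mpoly k[n]}) :
  is_space X -> opens X V ->
  (forall i : 'I_n, regular X V (fun x => (phi x)`_i)) ->
  regular X V (fun x => peval p (phi x)).
Proof.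
move=> sX oV h.
apply: (@regular_ext _ _ sX V
  (fun x => \sum_(m <- msupp p) p@_m * \prod_(i < n) (phi x)`_i ^+ m i)).
  apply: regular_sum => // m; apply: (regularM sX).
    exact: (regular_cst sX).
  by apply: regular_prod => // i; apply: regularX.
by move=> x _; rewrite /peval mevalE.
Qed.

Lemma morphism_to_affine X n S (phi : vpoint k -> vpoint k) :
  is_space X -> has_inverses X ->
  (forall x, carrier X x -> size (phi x) = n /\ S (phi x)) ->
  (forall i : 'I_n, regular X X (fun x => (phi x)`_i)) ->
  is_morphism X (restrict (affine_space k n) S) phi.
Proof.
move=> sX iX hS hphi.
have oX := open_full sX.
have nz (b : {mpoly k[n]}) : opens X (X `&` [set x | peval b (phi x) != 0]).
  apply: (regular_open sX); apply: iX.
  exact: regular_peval.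
have mo V : opens (restrict (affine_space k n) S) V -> opens X (X `&` phi @^-1` V).
  move=> [W /open_affineP[sW hW] VE]; apply: (open_local sX) => x [Xx /=].
  rewrite VE => -[Wx Sx]; have [p px hp] := hW _ Wx.
  exists (X `&` [set x | peval p (phi x) != 0]); split=> // y [Xy /= py].
  split=> //=; have [sy Sy] := hS y Xy.
  by split=> //; apply: hp.
split=> //.
move=> V g [oV hg].
  apply: (regular_glue sX); first exact: mo.
  move=> x [Xx /= Vx].
  have [W [u [/regular_affineP[oW hW] Wx gu]]] := hg _ Vx.
  have [a [b [bx hab]]] := hW _ Wx.
  exists ((X `&` phi @^-1` V) `&` (X `&` [set x | peval b (phi x) != 0])).
  split=> //.
  have oI := open_setI sX (mo _ oV) (nz b).
  have rb : regular X X (fun x => peval b (phi x)) by apply: regular_peval.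
  have ra : regular X X (fun x => peval a (phi x)) by apply: regular_peval.
  have ri := iX _ _ rb.
  have ra' := regular_res sX ra oI (fun y (h : (_ `&` _) y) => h.1.1).
  have ri' := regular_res sX ri oI (fun y (h : (_ `&` _) y) => h.2).
  apply: (regular_ext sX (regularM sX ra' ri')) => y [[Xy /= Vy] [_ /= by_]].
  have [sy _] := hS y Xy; have [Wy uE] := hab _ sy by_.
  by rewrite gu.
Qed.

Lemma morphism_comp X Y (Z : space k) f g : is_space X ->
  is_morphism X Y f -> is_morphism Y Z g ->
  is_morphism X Z (g \o f).
Proof.
move=> sX [s1 o1 r1] [s2 o2 r2].
have E V : X `&` (g \o f) @^-1` V = X `&` f @^-1` (Y `&` g @^-1` V).
  by apply/seteqP; split=> x [Xx /=] => [h|[]//]; split=> //=; split=> //; apply: s1.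
split=> [x /s1/s2 //|V /o2/o1|V h /r2/r1]; by rewrite E.
Qed.

Lemma is_affine_has_inverses X : is_affine X -> has_inverses X.
Proof.
move=> [sX [n [P [f [g [mf mg fg gf]]]]]] V u ru.
have iY := restrict_has_inverses (S := zeros P) (affine_is_space n)
  (@affine_has_inverses n).
have r1 := mor_regular mf (iY _ _ (mor_regular mg ru)).
have VX : V `<=` X := open_sub sX (regular_open sX ru).
set D := (X in regular _ X _) in r1.
have DE : D = V `&` [set x | u x != 0].
  apply/seteqP; split=> x.
    move=> [Xx [[_ /=] ]]; have /= -> := fg x Xx.
    by [].
  move=> [Vx /= ux]; have Xx := VX _ Vx.
  split=> //=; have /= E := fg x Xx; split=> //=; last by rewrite E.
  by split; [exact: (mor_sub mf)|rewrite /= E].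
rewrite -DE; apply: (regular_ext sX r1) => x [Xx _] /=.
by have /= -> := fg x Xx.
Qed.

Lemma restrict_separated n S : is_separated (restrict (affine_space k n) S).
Proof.
move=> Z f g aZ mf mg; have [sZ _] := aZ; have iZ := is_affine_has_inverses aZ.
split; first by move=> x [].
have sA := affine_is_space n.
have oA := open_full sA.
have coordR h (i : 'I_n) : is_morphism Z (restrict (affine_space k n) S) h ->
    regular Z Z (fun z => (h z)`_i).
  move=> mh.
  have r0 : regular (restrict (affine_space k n) S)
      (restrict (affine_space k n) S) (fun x => x`_i).
    split; first by exists (affine_space k n).
    move=> x [Ax Sx]; exists (affine_space k n), (fun x => x`_i); split=> //.
    exact: regular_coord.
  apply: (regular_res sZ (mor_regular mh r0)); first exact: (open_full sZ).
  by move=> z Zz; split=> //; apply: (mor_sub mh).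
apply: (open_local sZ) => z [Zz nfg].
have [sf _] := mor_sub mf Zz; have [sg _] := mor_sub mg Zz.
have [i fgi] : exists i : 'I_n, (f z)`_i - (g z)`_i != 0.
  apply: contrapT => hn; apply: nfg; split=> //=.
  apply: (@eq_from_nth _ 0); rewrite ?sf ?sg// => i lt_i.
  apply/eqP; rewrite -subr_eq0; apply: contrapT => /negP h; apply: hn.
  by exists (Ordinal lt_i).
have rd : regular Z Z (fun z => (f z)`_i - (g z)`_i).
  have rg := coordR g i mg; have rf := coordR f i mf.
  have rm := regularM sZ (regular_cst sZ (-1) (open_full sZ)) rg.
  apply: (regular_ext sZ (regularD sZ rf rm)) => y _.
  by rewrite mulN1r.
exists (Z `&` [set z | (f z)`_i - (g z)`_i != 0]); split=> //.
  exact: (regular_open sZ (iZ _ _ rd)).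
move=> y [Zy /= fgy]; split=> // -[_ /= E].
by rewrite E subrr eqxx in fgy.
Qed.

Lemma peval_widen n (p : {mpoly k[n]}) x :
  peval (mwiden p) x = peval p x.
Proof.
rewrite /peval [p in mwiden p]mpolyE (raddf_sum (@mwiden n k)) [in RHS]mevalE.
rewrite (raddf_sum (meval (fun i : 'I_n.+1 => x`_i))).
apply: eq_bigr => m _ /=; rewrite mwidenZ mwidenX mevalZ mevalX.
rewrite big_ord_recr /= mnmwiden_ordmax expr0 mulr1.
by congr (_ * _); apply: eq_bigr => i _; rewrite mnmwiden_widen.
Qed.

Lemma peval_take n (p : {mpoly k[n]}) x : peval p (take n x) = peval p x.
Proof. by apply: meval_eq => i; rewrite nth_take. Qed.

Lemma peval_rcons n (p : {mpoly k[n]}) x c : size x = n ->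
  peval p (rcons x c) = peval p x.
Proof.
by move=> sx; rewrite -peval_take -cats1 take_size_cat.
Qed.

Lemma basic_is_affine n (P : set {mpoly k[n]}) (g : {mpoly k[n]}) :
  is_affine (restrict (affine_space k n)
    (zeros P `&` [set x | peval g x != 0])).
Proof.
set S := _ `&` _.
have sA := affine_is_space n; have sB := affine_is_space n.+1.
have sS := restrict_is_space S sA.
have iS := restrict_has_inverses (S := S) sA (@affine_has_inverses n).
split=> //.
pose Q := [set q : {mpoly k[n.+1]} | (exists2 p, P p & q = mwiden p) \/
   q = mwiden g * 'X_ord_max - 1%:MP].
exists n.+1, Q, (fun x => rcons x (peval g x)^-1), (take n); split.
- apply: morphism_to_affine => //.
    move=> x [_ [[sx Px] /= gx]]; split; first by rewrite size_rcons sx.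
    split; first by rewrite size_rcons sx.
    move=> q [[p Pp ->]|->].
      by rewrite peval_widen peval_rcons// Px.
    rewrite pevalB pevalM peval_cst pevalX peval_widen peval_rcons//=.
    by rewrite nth_rcons sx ltnn eqxx divff// subrr.
  move=> i.
  have rc (j : 'I_n) : regular (restrict (affine_space k n) S)
      (restrict (affine_space k n) S) (fun x => x`_j).
    apply: (restrict_open_regular sA (open_full sA)); last exact: regular_coord.
    by move=> x [[]].
  have rg : regular (restrict (affine_space k n) S)
      (restrict (affine_space k n) S) (fun x => peval g x).
    by apply: (regular_peval (phi := id)) => //; apply: (open_full sS).
  have rgi : regular (restrict (affine_space k n) S)
      (restrict (affine_space k n) S) (fun x => (peval g x)^-1).
    apply: (regular_res sS (iS _ _ rg)); first exact: (open_full sS).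
    by move=> x Xx; split=> //; case: Xx => _ [].
  case: (unliftP ord_max i) => [j|] ->.
    apply: (regular_ext sS (rc j)) => x [sx _].
    by rewrite nth_rcons lift_max sx ltn_ord.
  by apply: (regular_ext sS rgi) => x [sx _]; rewrite nth_rcons sx ltnn eqxx.
- have sQ := restrict_is_space (zeros Q) sB.
  apply: morphism_to_affine => //.
    exact/restrict_has_inverses/affine_has_inverses.
    move=> x [sx [_ Qx]].
    have sx' : size (take n x) = n by rewrite size_takel// sx.
    split=> //; split; first split=> //.
      move=> p Pp; rewrite peval_take -peval_widen; apply: Qx.
      by left; exists p.
    have /eqP := Qx _ (or_intror erefl).
    rewrite pevalB pevalM peval_cst pevalX peval_widen subr_eq0 => /eqP E.
    rewrite /= peval_take; apply: contraTneq isT => g0.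
    by move/eqP: E; rewrite g0 mul0r eq_sym oner_eq0.
  move=> i; have le_n : (n <= n.+1)%N by [].
  apply: (@regular_ext _ _ sQ _ (fun x => x`_(widen_ord le_n i))).
    apply: (restrict_open_regular sB (open_full sB)); last exact: regular_coord.
    by move=> x [].
  by move=> x _; rewrite nth_take.
- by move=> x [sx _] /=; rewrite -cats1 take_size_cat.
- move=> x [sx [_ Qx]] /=.
  have /eqP := Qx _ (or_intror erefl).
  rewrite pevalB pevalM peval_cst pevalX peval_widen subr_eq0 => /eqP E.
  have g0 : peval g x != 0.
    by apply: contraTneq isT => g0; move/eqP: E; rewrite g0 mul0r eq_sym oner_eq0.
  have -> : (peval g (take n x))^-1 = x`_n.
    by rewrite peval_take; apply: (mulfI g0); rewrite divff.
  by rewrite -take_nth ?sx// -sx take_size.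
Qed.

Lemma locally_closed_is_variety n (P : set {mpoly k[n]}) (N : nat)
    (g : 'I_N -> {mpoly k[n]}) S :
  S = zeros P `&` [set x | exists i, peval (g i) x != 0] ->
  is_variety (restrict (affine_space k n) S).
Proof.
move=> SE; have sA := affine_is_space n.
split; [exact: restrict_is_space| |exact: restrict_separated].
pose D i := [set x : vpoint k | size x = n /\ peval (g i) x != 0].
have SD i : S `&` D i = zeros P `&` [set x | peval (g i) x != 0].
  rewrite SE; apply/seteqP; split=> x; first by move=> [[Zx _] [_ gx]]; split.
  by move=> [Zx gx]; split; [split=> //; exists i|split=> //; case: Zx].
exists N, (fun i => S `&` D i); split=> [i|].
  split.
    exists (D i); last by rewrite setIC.
    by apply/open_affineP; split=> [x []//|x [sx gx]]; exists (g i).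
  rewrite (restrict_restrict _ _ sA) setIA setIid SD.
  exact: basic_is_affine.
apply/seteqP; split=> x.
  move=> [sx Sx]; move: (Sx); rewrite {1}SE => -[_ [i gx]].
  by exists i => //; split.
by move=> [i _ [Sx [sx _]]]; split.
Qed.

End VarietyTheory.

Section Burnside.
Variables (k : closedFieldType) (r : nat) (E : 'M[k]_(r * r)).
Hypothesis E1 : (mxvec 1%:M <= E)%MS.
Hypothesis EM : forall M N : 'M[k]_r,
  (mxvec M <= E)%MS -> (mxvec N <= E)%MS -> (mxvec (M *m N) <= E)%MS.
Hypothesis irrE : forall W : 'M[k]_r,
  (forall M, (mxvec M <= E)%MS -> stablemx W M) -> W = 0 \/ row_full W.

Lemma algD (M N : 'M[k]_r) :
  (mxvec M <= E)%MS -> (mxvec N <= E)%MS -> (mxvec (M + N) <= E)%MS.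
Proof. by move=> hM hN; rewrite linearD addmx_sub. Qed.

Lemma algZ (a : k) (M : 'M[k]_r) : (mxvec M <= E)%MS -> (mxvec (a *: M) <= E)%MS.
Proof. by move=> hM; rewrite linearZ scalemx_sub. Qed.

Lemma alg_orbit (u v : 'rV[k]_r) : u != 0 ->
  exists2 M, (mxvec M <= E)%MS & u *m M = v.
Proof.
move=> u0; pose W := <<E *m lin_mul_row u>>%MS.
have memW w : reflect (exists2 M, (mxvec M <= E)%MS & u *m M = w) (w <= W)%MS.
  rewrite genmxE; apply: (iffP submxP) => [[D ->]|[M /submxP[D DE] <-]].
    exists (vec_mx (D *m E)); first by rewrite vec_mxK submxMl.
    by rewrite mulmxA -[D *m E]vec_mxK mul_vec_lin_row vec_mxK.
  by exists D; rewrite mulmxA -DE mul_vec_lin_row.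
have [M hM|W0|fW] := irrE (W := W).
- apply/row_subP => i; rewrite row_mul.
  have /memW[N hN <-] := row_sub i W.
  by apply/memW; exists (N *m M); [exact: EM|rewrite mulmxA].
- have : (u <= W)%MS by apply/memW; exists 1%:M; rewrite // mulmx1.
  by rewrite W0 submx0 (negbTE u0).
- by apply/memW; apply: submx_full.
Qed.

Lemma alg_rank1 : (0 < r)%N -> exists2 T, (mxvec T <= E)%MS & \rank T = 1%N.
Proof.
move=> r0.
have [d [T hT [dT dmin]]] : exists d, exists2 T, (mxvec T <= E)%MS &
    \rank T = d.+1 /\ forall N, (mxvec N <= E)%MS -> N != 0 -> (d < \rank N)%N.
  pose P d := `[< exists2 T, (mxvec T <= E)%MS & \rank T = d.+1 >].
  have exP : exists d, P d.
    exists r.-1; apply/asboolP; exists 1%:M => //.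
    by rewrite mxrank1 prednK.
  case: (ex_minnP exP) => d /asboolP[T hT dT] dmin; exists d, T => //.
  split=> // N hN N0; have := mxrank_eq0 N; rewrite (negbTE N0) => /negbT.
  rewrite -lt0n => rN; rewrite -ltnS -(prednK rN) ltnS ltnS.
  by apply: dmin; apply/asboolP; exists N; rewrite ?prednK.
exists T => //; rewrite dT; congr _.+1.
apply/eqP; rewrite -leqn0 leqNgt; apply/negP => d0.
have T0 : T != 0 by rewrite -mxrank_eq0 dT.
have /rowV0Pn[x1 /submxP[y1 y1E] x10] := T0.
have nle : ~~ (T <= x1)%MS.
  apply/negP => /mxrankS; rewrite dT leqNgt => /negP; apply.
  by rewrite (leq_ltn_trans (rank_leq_row _)).
have /row_subPn[i ni] := nle.
have [M hM ME] := alg_orbit (delta_mx 0 i) x10.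
pose Nn := M *m T.
have [lam [v [v0 vT vN]]] : exists lam (v : 'rV[k]_r),
    [/\ v != 0, (v <= T)%MS & v *m Nn = lam *: v].
  pose V := row_base T.
  have sV : (V *m Nn <= V)%MS by rewrite /V /Nn mulmxA eq_row_base submxMl.
  have /submxP[Rm RE] := sV.
  have rT : (0 < \rank T)%N by rewrite dT.
  have : size (char_poly Rm) != 1%N by rewrite size_char_poly; case: (\rank T) rT.
  move=> /closed_rootP[lam]; rewrite -eigenvalue_root_char => /eigenvalueP[w wE w0].
  exists lam, (w *m V); split.
  - by rewrite mulmx_free_eq0 ?row_base_free.
  - by rewrite -(eq_row_base T) submxMl.
  - by rewrite -mulmxA RE mulmxA wE scalemxAl.
pose F := Nn - lam%:M.
have hTF : (mxvec (T *m F) <= E)%MS.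
  rewrite /F mulmxBr mul_mx_scalar -scaleNr; apply: algD; last exact: algZ.
  by rewrite /Nn; apply: EM => //; apply: EM.
have TF0 : T *m F != 0.
  apply: contraNneq ni => TF0.
  have : y1 *m T *m F = 0 by rewrite -mulmxA TF0 mulmx0.
  rewrite -y1E /F mulmxBr mul_mx_scalar /Nn mulmxA ME -rowE => /eqP.
  by rewrite subr_eq0 => /eqP ->; apply: scalemx_sub.
have := dmin _ hTF TF0; rewrite ltnNge => /negP; apply.
have := mxrank_mul_ker T F; rewrite dT => rE.
rewrite -ltnS -rE -[X in (X < _)%N]addn0 ltn_add2l lt0n mxrank_eq0.
apply/rowV0Pn; exists v => //; rewrite sub_capmx vT; apply/sub_kermxP.
by rewrite /F mulmxBr vN mul_mx_scalar subrr.
Qed.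

Lemma burnside (M : 'M[k]_r) : (0 < r)%N -> (mxvec M <= E)%MS.
Proof.
move=> r0; have [T hT rT] := alg_rank1 r0.
have [c [u TE]] : exists (c : 'cV[k]_r) (u : 'rV[k]_r), T = c *m u.
  have := mulmx_base T; move: (col_base T) (row_base T).
  by rewrite rT => c u <-; exists c, u.
have T0 : T != 0 by rewrite -mxrank_eq0 rT.
have c0 : c != 0 by apply: contraNneq T0 => c0; rewrite TE c0 mul0mx.
have u0 : u != 0 by apply: contraNneq T0 => u0; rewrite TE u0 mulmx0.
pose C : 'M[k]_(r * r, r) := \matrix_i (vec_mx (row i E) *m c)^T.
have rowC i : row i C = (vec_mx (row i E) *m c)^T by rewrite rowK.
have CE (x : 'rV_(r * r)) : x *m C = (vec_mx (x *m E) *m c)^T.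
  rewrite mulmx_sum_row (mulmx_sum_row x E) !linear_sum /= mulmx_suml linear_sum.
  by apply: eq_bigr => i _; rewrite rowC linearZ /= -scalemxAl linearZ.
have fC : row_full C.
  apply: contraT => nf.
  have /rowV0Pn[x /sub_kermxP xC x0] : kermx C^T != 0.
    by rewrite kermx_eq0 /row_free mxrank_tr.
  have xM N : (mxvec N <= E)%MS -> x *m N *m c = 0.
    move=> /submxP[D DE]; have := CE D; rewrite -DE mxvecK => DC.
    apply: trmx_inj; rewrite -mulmxA trmx_mul -DC trmx0.
    by rewrite -mulmxA -[C]trmxK -trmx_mul xC trmx0 mulmx0.
  case/negP: c0; apply/eqP/matrixP => i j; rewrite ord1.
  have [N hN NE] := alg_orbit (delta_mx 0 i) x0.
  by have := xM _ hN; rewrite NE -rowE => /matrixP/(_ 0 0); rewrite !mxE.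
have col (v : 'cV[k]_r) : exists2 N, (mxvec N <= E)%MS & N *m c = v.
  have /submxP[D DE] : (v^T <= C)%MS by apply: submx_full.
  exists (vec_mx (D *m E)); first by rewrite vec_mxK submxMl.
  by apply: trmx_inj; rewrite -CE.
have hd i j : (mxvec (delta_mx i j : 'M[k]_r) <= E)%MS.
  have [N hN NE] := col (delta_mx i 0).
  have [N' hN' NE'] := alg_orbit (delta_mx 0 j) u0.
  have -> : delta_mx i j = N *m T *m N'.
    by rewrite TE mulmxA NE -mulmxA NE' mul_delta_mx.
  by apply: EM => //; apply: EM.
rewrite [M]matrix_sum_delta linear_sum summx_sub// => i _.
rewrite linear_sum summx_sub// => j _; exact: algZ.
Qed.

End Burnside.

Section Words.
Variables (k : closedFieldType) (r : nat).
Implicit Types A B W M : 'M[k]_r.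

Definition letter A B (c : option bool) : 'M[k]_r :=
  match c with None => 1%:M | Some true => A | Some false => B end.

Definition word A B (w : seq (option bool)) : 'M[k]_r :=
  foldr (fun c M => M *m letter A B c) 1%:M w.

Definition alg_step A B (E : 'M[k]_(r * r)) : 'M[k]_(r * r) :=
  (E + (E *m lin_mulmxr A + E *m lin_mulmxr B))%MS.

Definition alg_iter A B j := iter j (alg_step A B) <<mxvec 1%:M>>%MS.

Definition word_mx A B L : 'M[k]_(#|{: L.-tuple (option bool)}|, r * r) :=
  \matrix_i mxvec (word A B (tval (enum_val i : L.-tuple (option bool)))).

Lemma alg_iter_sub A B L : (alg_iter A B L <= word_mx A B L)%MS.
Proof.
have key : forall L (w : seq (option bool)), size w = L ->
    (mxvec (word A B w) <= word_mx A B L)%MS.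
  move=> L' w sw; have -> : w = in_tuple w by [].
  move: (in_tuple w); rewrite sw => t.
  apply: (eq_row_sub (enum_rank t)).
  by rewrite rowK enum_rankK.
have step c L' : (word_mx A B L' *m lin_mulmxr (letter A B c) <= word_mx A B L'.+1)%MS.
  apply/row_subP => i; rewrite row_mul rowK mul_vec_lin /=.
  by apply: (key _ (c :: tval (enum_val i))); rewrite /= size_tuple.
elim: L => [|L IH]; first by rewrite genmxE; apply: (key _ [::]).
rewrite /alg_iter iterS -/(alg_iter A B L) /alg_step !addsmx_sub.
apply/and3P; split.
- apply: submx_trans IH _; apply/row_subP => i; rewrite rowK.
  rewrite -[word A B _]mulmx1.
  by apply: (key _ (None :: tval (enum_val i))); rewrite /= size_tuple.
- exact: submx_trans (submxMr _ IH) (step (Some true) L).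
- exact: submx_trans (submxMr _ IH) (step (Some false) L).
Qed.

Lemma alg_iterS_sub A B i j : (i <= j)%N -> (alg_iter A B i <= alg_iter A B j)%MS.
Proof.
move=> /subnK <-; elim: (j - i)%N => //= n IH.
by apply: submx_trans IH _; apply: addsmxSl.
Qed.

Lemma alg_iter_stable A B : (alg_iter A B (r * r).+1 <= alg_iter A B (r * r))%MS.
Proof.
have [j jr hj] : exists2 j, (j <= r * r)%N &
    (alg_iter A B j.+1 <= alg_iter A B j)%MS.
  apply: contrapT => hn.
  have h j : (j <= (r * r).+1)%N -> (j <= \rank (alg_iter A B j))%N.
    elim: j => // j IH lt_j; apply: leq_ltn_trans (IH (ltnW lt_j)) _.
    apply: rank_ltmx; rewrite ltmxE alg_iterS_sub//=.
    by apply/negP => h; apply: hn; exists j.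
  by have := h _ (leqnn _); rewrite leqNgt ltnS rank_leq_col.
suff H n : (alg_iter A B (n + j).+1 <= alg_iter A B (n + j))%MS.
  by have := H (r * r - j)%N; rewrite (subnK jr).
elim: n => [|n IH]; first exact: hj.
rewrite addSn.
set X := alg_iter A B (n + j).+1 in IH *.
have -> : alg_iter A B (n + j).+2 = alg_step A B X by [].
have XE : X = alg_step A B (alg_iter A B (n + j)) by [].
rewrite /alg_step addsmx_sub submx_refl addsmx_sub {2 4}XE /=.
apply/andP; split.
  apply: submx_trans (submxMr _ IH) _; apply: submx_trans (addsmxSr _ _).
  exact: addsmxSl.
apply: submx_trans (submxMr _ IH) _; apply: submx_trans (addsmxSr _ _).
exact: addsmxSr.
Qed.

Lemma alg_iter_mulr A B M L : (mxvec M <= alg_iter A B L)%MS ->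
  (mxvec (M *m A) <= alg_iter A B L.+1)%MS /\
  (mxvec (M *m B) <= alg_iter A B L.+1)%MS.
Proof.
move=> hM; split.
  rewrite -[M *m A]/(mulmxr A M) -mul_vec_lin.
  apply: submx_trans (submxMr _ hM) _; apply: submx_trans (addsmxSr _ _).
  exact: addsmxSl.
rewrite -[M *m B]/(mulmxr B M) -mul_vec_lin.
apply: submx_trans (submxMr _ hM) _; apply: submx_trans (addsmxSr _ _).
exact: addsmxSr.
Qed.

Definition row_irreducible A B := forall W : 'M[k]_r,
  stablemx W A -> stablemx W B -> W = 0 \/ row_full W.

Lemma stable_word A B W w : stablemx W A -> stablemx W B ->
  stablemx W (word A B w).
Proof.
move=> hA hB; elim: w => [|c w IH] /=; first exact: stablemxC.
by apply: stablemxM => //; case: c => [[]|] //; apply: stablemxC.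
Qed.

Lemma word_full A B : (0 < r)%N -> row_irreducible A B ->
  row_full (word_mx A B (r * r)).
Proof.
move=> r0 irr; rewrite -sub1mx; apply: submx_trans (alg_iter_sub A B (r * r)).
set E := alg_iter A B (r * r).
have E1 : (mxvec 1%:M <= E)%MS.
  by apply: submx_trans (alg_iterS_sub A B (leq0n _)); rewrite genmxE.
have Er M : (mxvec M <= E)%MS -> (mxvec (M *m A) <= E)%MS /\ (mxvec (M *m B) <= E)%MS.
  move=> /alg_iter_mulr[hA hB].
  by split; [apply: submx_trans hA _|apply: submx_trans hB _]; exact: alg_iter_stable.
have EM M N : (mxvec M <= E)%MS -> (mxvec N <= E)%MS -> (mxvec (M *m N) <= E)%MS.
  move=> hM; rewrite -{2}[N]mxvecK => /(submx_trans)/(_ (alg_iter_sub A B _)).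
  move=> /submxP[D ->]; rewrite mulmx_sum_row !linear_sum /=.
  rewrite summx_sub// => i _; rewrite !linearZ /= scalemx_sub// rowK mxvecK.
  elim: (tval _) => [|c w IH] /=; first by rewrite mulmx1.
  rewrite mulmxA; case: c => [[]|] /=; first by have [] := Er _ IH.
    by have [] := Er _ IH.
  by rewrite mulmx1.
have irrE W : (forall M, (mxvec M <= E)%MS -> stablemx W M) -> W = 0 \/ row_full W.
  move=> hW; have [hA hB] := Er _ E1; rewrite !mul1mx in hA hB.
  by apply: irr; apply: hW.
by apply/rV_subP => v _; rewrite -[v]vec_mxK; apply: burnside.
Qed.

Definition word_det A B
    (f : {ffun 'I_(r * r) -> (r * r).-tuple (option bool)}) : k :=
  \det (\matrix_i mxvec (word A B (f i)) : 'M_(r * r)).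

Lemma irreducible_word_det A B : (0 < r)%N ->
  row_irreducible A B <-> exists f, word_det A B f != 0.
Proof.
move=> r0; split=> [irr|[f fN]].
  have fW := word_full r0 irr.
  exists [ffun i => enum_val (fullrankfun fW i)].
  rewrite /word_det -unitfE -[_ \is a _]/(_ \in unitmx) -row_full_unit.
  set W := \matrix_i _.
  suff -> : W = rowsub (fullrankfun fW) (word_mx A B (r * r)).
    exact: fullrowsub_full.
  by apply/row_matrixP => i; rewrite row_rowsub !rowK ffunE.
move=> W hA hB; have [->|W0] := eqVneq W 0; [by left|right].
have hM M : stablemx W M.
  move: fN; rewrite /word_det; set F := \matrix_i _ => fN.
  have /submxP[D DE] : (mxvec M <= F)%MS.
    apply: submx_full; rewrite row_full_unit unitmxE unitfE.
    exact: fN.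
  rewrite -[M]mxvecK DE mulmx_sum_row linear_sum /= mulmx_sumr.
  rewrite summx_sub// => i _; rewrite linearZ /= -scalemxAr scalemx_sub//.
  by rewrite rowK mxvecK; apply: stable_word.
have [i [j Wij]] : exists i j, W i j != 0.
  apply: contrapT => hn; case/negP: W0; apply/eqP/matrixP => i j.
  by rewrite mxE; apply/eqP; apply: contrapT => /negP h; apply: hn; exists i, j.
rewrite -sub1mx; apply/row_subP => l; rewrite row1.
have E : row i W *m delta_mx j l = W i j *: delta_mx 0 l.
  apply/rowP => c; rewrite !mxE (bigD1 j)//= big1 => [|j' nj]; rewrite !mxE ?eqxx.
    by rewrite addr0.
  by rewrite (negbTE nj) mulr0.
rewrite -[delta_mx 0 l](scalerK Wij) -E scalemx_sub// -row_mul.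
by apply: submx_trans (row_sub _ _) (hM _).
Qed.

End Words.

Section RepresentationVarieties.
Variable k : closedFieldType.
Implicit Types (s x : vpoint k).

Lemma restrict_full (X : space k) : is_space X -> restrict X X = X.
Proof.
move=> sX.
have opE V : (exists2 W, opens X W & V = W `&` X) = opens X V.
  apply: propext; split=> [[W oW ->]|oV].
    by rewrite setIidl//; apply: (open_sub sX).
  by exists V => //; rewrite setIidl//; apply: (open_sub sX).
rewrite /restrict /=; case: X sX opE => c o rg /= sX opE.
congr Space; first by rewrite setIid.
  by apply/funext => V; apply: opE.
apply/funext => V; apply/funext => f; apply: propext; rewrite /= opE; split.
  move=> [oV h]; apply: (regular_glue sX) => // x Vx.
  have [W [g [rW Wx fg]]] := h x Vx.
  exists (V `&` W); split=> //.
  apply: (regular_ext sX) (_ : eq_on (V `&` W) g f).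
    apply: (regular_res sX rW); last by move=> y [].
    by apply: (open_setI sX) => //; apply: (regular_open sX rW).
  by move=> y h'; rewrite fg.
move=> rV; split; first exact: (regular_open sX rV).
by move=> x Vx; exists V, f; split.
Qed.

Definition polyfun n (f : vpoint k -> k) :=
  exists p : {mpoly k[n]}, forall x, f x = peval p x.

Lemma polyfun_cst n c : polyfun n (fun=> c).
Proof. by exists c%:MP => x; rewrite peval_cst. Qed.

Lemma polyfun_coord n i : (i < n)%N -> polyfun n (fun s => s`_i).
Proof. by move=> lt_i; exists 'X_(Ordinal lt_i) => x; rewrite pevalX. Qed.

Lemma polyfunD n f g : polyfun n f -> polyfun n g -> polyfun n (fun x => f x + g x).
Proof. by move=> [p hp] [q hq]; exists (p + q) => x; rewrite pevalD hp hq. Qed.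

Lemma polyfunM n f g : polyfun n f -> polyfun n g -> polyfun n (fun x => f x * g x).
Proof. by move=> [p hp] [q hq]; exists (p * q) => x; rewrite pevalM hp hq. Qed.

Lemma polyfunB n f g : polyfun n f -> polyfun n g -> polyfun n (fun x => f x - g x).
Proof. by move=> [p hp] [q hq]; exists (p - q) => x; rewrite pevalB hp hq. Qed.

Lemma polyfun_eq n f g : f =1 g -> polyfun n f -> polyfun n g.
Proof. by move=> fg [p hp]; exists p => x; rewrite -fg hp. Qed.

Lemma polyfun_sum n (I : Type) (r : seq I) (F : I -> vpoint k -> k) :
  (forall i, polyfun n (F i)) -> polyfun n (fun x => \sum_(i <- r) F i x).
Proof.
move=> h; elim: r => [|i r IH].
  by apply: polyfun_eq (polyfun_cst n 0) => x; rewrite big_nil.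
by apply: polyfun_eq (polyfunD (h i) IH) => x; rewrite big_cons.
Qed.

Lemma polyfun_prod n (I : Type) (r : seq I) (F : I -> vpoint k -> k) :
  (forall i, polyfun n (F i)) -> polyfun n (fun x => \prod_(i <- r) F i x).
Proof.
move=> h; elim: r => [|i r IH].
  by apply: polyfun_eq (polyfun_cst n 1) => x; rewrite big_nil.
by apply: polyfun_eq (polyfunM (h i) IH) => x; rewrite big_cons.
Qed.

Definition polymx n a b (F : vpoint k -> 'M[k]_(a, b)) :=
  forall i j, polyfun n (fun s => F s i j).

Lemma polymxM n a b c (F : vpoint k -> 'M[k]_(a, b)) (F' : vpoint k -> 'M[k]_(b, c)) :
  polymx n F -> polymx n F' -> polymx n (fun s => F s *m F' s).
Proof.
move=> h h' i j.
apply: (@polyfun_eq _ (fun s => \sum_l F s i l * F' s l j)).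
  by move=> x; rewrite mxE.
by apply: polyfun_sum => l; apply: polyfunM.
Qed.

Lemma polymx_cst n a b (M : 'M[k]_(a, b)) : polymx n (fun=> M).
Proof. by move=> i j; apply: polyfun_cst. Qed.

Lemma polymxX n a (F : vpoint k -> 'M[k]_a) e :
  polymx n F -> polymx n (fun s => F s ^+ e).
Proof.
move=> h; elim: e => [|e IH]; first exact: polymx_cst.
have := polymxM h IH; congr (polymx n _).
by apply/funext => s; rewrite exprS.
Qed.

Lemma polyfun_det n a (F : vpoint k -> 'M[k]_a) :
  polymx n F -> polyfun n (fun s => \det (F s)).
Proof.
move=> h; apply: polyfun_sum => s; apply: polyfunM; first exact: polyfun_cst.
by apply: polyfun_prod => i; apply: h.
Qed.

Lemma polymx_word n r (F F' : vpoint k -> 'M[k]_r) w :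
  polymx n F -> polymx n F' -> polymx n (fun s => word (F s) (F' s) w).
Proof.
move=> h h'; elim: w => [|c w IH] /=; first exact: polymx_cst.
by apply: polymxM => //; case: c => [[]|] //=; apply: polymx_cst.
Qed.

Lemma polyfun_word_det n r (F F' : vpoint k -> 'M[k]_r) f :
  polymx n F -> polymx n F' -> polyfun n (fun s => word_det (F s) (F' s) f).
Proof.
move=> h h'; apply: polyfun_det => i j; case/mxvec_indexP: j => a b.
apply: (polyfun_eq _ (polymx_word (f i) h h' a b)) => s.
by rewrite [RHS]mxE mxvecE.
Qed.

Lemma polymx_coord r off n : (off + r * r <= n)%N ->
  polymx n (coord_mx r off : vpoint k -> 'M[k]_r).
Proof.
move=> le_n i j.
apply: (@polyfun_eq _ (fun s => s`_(off + (i * r + j)))).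
  by move=> s; rewrite mxE.
apply: polyfun_coord; apply: leq_trans le_n; rewrite ltn_add2l.
apply: (@leq_trans (i * r + r)); first by rewrite ltn_add2l.
by rewrite -mulSnr leq_mul2r ltn_ord orbT.
Qed.

Lemma polyfun_is_variety n (I : finType) (H : set (vpoint k -> k))
    (G : I -> vpoint k -> k) (S : set (vpoint k)) :
  (forall h, H h -> polyfun n h) -> (forall i, polyfun n (G i)) ->
  (forall s, S s <-> [/\ size s = n, forall h, H h -> h s = 0 &
                       exists i, G i s != 0]) ->
  is_variety (restrict (affine_space k n) S).
Proof.
move=> hH hG hS.
have /choice[g gE] : forall i, exists p : {mpoly k[n]}, forall x, G i x = peval p x.
  by [].
apply: (@locally_closed_is_variety k n
  [set p | exists2 h, H h & forall x, h x = peval p x] #|I|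
  (fun i => g (enum_val i))).
apply/seteqP; split=> s.
  move=> /hS[ss hs [i Gi]]; split.
    by split=> // p [h /hs hs0 <-].
  by exists (enum_rank i); rewrite enum_rankK -gE.
move=> [[ss hs] [i gi]]; apply/hS; split=> //.
  by move=> h Hh; have [p hp] := hH _ Hh; rewrite hp; apply: hs; exists h.
by exists (enum_val i); rewrite gE.
Qed.

Lemma stablemx_invmx r (W A : 'M[k]_r) : A \in unitmx ->
  stablemx W A -> stablemx W (invmx A).
Proof.
move=> uA hW; have fA : row_free A by rewrite row_free_unit.
have : (W <= W *m A)%MS.
  by rewrite -(mxrank_leqif_sup hW) (mxrankMfree _ fA).
by move=> /(submxMr (invmx A)); rewrite mulmxK.
Qed.

Lemma irreducible_repP r (A B : 'M[k]_r) : A \in unitmx -> B \in unitmx ->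
  irreducible_rep A B <-> (0 < r)%N /\ row_irreducible A^T B^T.
Proof.
move=> uA uB; split=> -[r0 h]; split=> // W.
  move=> hA hB; apply: h => g; rewrite !inE => /or4P[] /eqP -> //.
    by rewrite trmx_inv stablemx_invmx// unitmx_tr.
  by rewrite trmx_inv stablemx_invmx// unitmx_tr.
by move=> hW; apply: h; apply: hW; rewrite !inE eqxx ?orbT.
Qed.

Lemma in_group_unit (G : group_kind) r (A : 'M[k]_r) : in_group G A -> A \in unitmx.
Proof. by case: G => //= dA; rewrite unitmxE dA unitr1. Qed.

Lemma in_groupI (G : group_kind) r (A : 'M[k]_r) : (G = SL -> \det A = 1) ->
  A \in unitmx -> in_group G A.
Proof. by case: G => //= h _; apply: h. Qed.

Lemma irr_rep_is_variety G n m r :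
  is_variety (restrict (affine_space k (r * r + r * r)) (irr_rep_set G n m r)).
Proof.
pose A := coord_mx r 0 : vpoint k -> 'M[k]_r.
pose B := coord_mx r (r * r) : vpoint k -> 'M[k]_r.
pose d := (r * r + r * r)%N.
have pA : polymx d A by apply: polymx_coord; rewrite add0n leq_addr.
have pB : polymx d B by exact: polymx_coord.
have pAt : polymx d (fun s => (A s)^T).
  by move=> i j; apply: polyfun_eq (pA j i) => s; rewrite [RHS]mxE.
have pBt : polymx d (fun s => (B s)^T).
  by move=> i j; apply: polyfun_eq (pB j i) => s; rewrite [RHS]mxE.
pose H : set (vpoint k -> k) := [set h |
  (exists i j, h = fun s => (A s ^+ n) i j - (B s ^+ m) i j) \/
  (G = SL /\ (h = (fun s => \det (A s) - 1) \/ h = (fun s => \det (B s) - 1)))].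
pose g (f : {ffun 'I_(r * r) -> (r * r).-tuple (option bool)}) s :=
  (0 < r)%:R * (\det (A s) * \det (B s)) * word_det (A s)^T (B s)^T f.
apply: (@polyfun_is_variety _ _ H g).
- move=> h [[i [j ->]]|[_ [->|->]]].
  + by apply: polyfunB; apply: polymxX.
  + by apply: polyfunB; [exact: polyfun_det|exact: polyfun_cst].
  + by apply: polyfunB; [exact: polyfun_det|exact: polyfun_cst].
- move=> f; apply: polyfunM; last exact: polyfun_word_det.
  by apply: polyfunM; [exact: polyfun_cst|apply: polyfunM; exact: polyfun_det].
move=> s; split.
  move=> [[ss [hA hB hAB]] /= irr]; split=> //.
    move=> h [[i [j ->]]|[GE [->|->]]].
    + by rewrite hAB subrr.
    + by move: hA; rewrite GE /= /A => ->; rewrite subrr.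
    + by move: hB; rewrite GE /= /B => ->; rewrite subrr.
  have uA := in_group_unit hA; have uB := in_group_unit hB.
  have [r0 /(irreducible_word_det _ _ r0)[f hf]] := (irreducible_repP uA uB).1 irr.
  exists f; rewrite /g r0 mul1r mulf_neq0// mulf_neq0//.
    by rewrite -unitfE -unitmxE.
  by rewrite -unitfE -unitmxE.
move=> [ss hH [f]]; rewrite /g !mulf_eq0 !negb_or => /andP[/andP[r0 /andP[dA dB]] hf].
have {}r0 : (0 < r)%N by case: (0 < r)%N r0 => //; rewrite eqxx.
have uA : A s \in unitmx by rewrite unitmxE unitfE.
have uB : B s \in unitmx by rewrite unitmxE unitfE.
split; last first.
  apply/(irreducible_repP uA uB); split=> //.
  by apply/irreducible_word_det => //; exists f.
split=> //; split.
- apply: in_groupI uA => GE; apply/eqP; rewrite -subr_eq0; apply/eqP.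
  by apply: (hH (fun s => \det (A s) - 1)); right; split=> //; left.
- apply: in_groupI uB => GE; apply/eqP; rewrite -subr_eq0; apply/eqP.
  by apply: (hH (fun s => \det (B s) - 1)); right; split=> //; right.
- apply/matrixP => i j; apply/eqP; rewrite -subr_eq0; apply/eqP.
  by apply: (hH (fun s => (A s ^+ n) i j - (B s ^+ m) i j)); left; exists i, j.
Qed.

Lemma affine_is_variety n : is_variety (affine_space k n).
Proof.
rewrite -(restrict_full (affine_is_space k n)).
apply: (@polyfun_is_variety n unit set0 (fun _ _ => 1)) => //.
  by move=> _; apply: polyfun_cst.
move=> s; split=> [ss|[]//]; split=> //.
by exists tt; rewrite oner_neq0.
Qed.

Definition affine_variety n : variety k := Variety (affine_is_variety n).

Definition irr_rep_variety G n m r : variety k :=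
  Variety (irr_rep_is_variety G n m r).

End RepresentationVarieties.

(* The class of the affine line. *)
Definition lefschetz (k : closedFieldType) : K0 k := K0_class (affine_variety k 1).

(* Main.v *)
(** Let R_1 be the set of irreducible pairs (A, B) in SL_r^2 with A^n = B^m = 1.
    By Schur's lemma, A^n = B^m = c for a scalar c if (A, B) is irreducible, and
    c^r = 1 on SL_r. If zeta is a primitive r-th root of unity, so is zeta^(mn),
    and (A, B) |-> (zeta^(mj) A, zeta^(nj) B) maps R_1 isomorphically onto the
    locus c = zeta^(mnj). These r loci are closed, so
    [R^irr(SL_r)] = r [R_1]. On the other hand,
    ((A, B), l) |-> (l^m A, l^n B) is an isomorphism from R_1 x G_m to
    R^irr(GL_r): its inverse recovers l as a Laurent monomial in det A, det B
    and c. So [R^irr(GL_r)] = (q - 1) [R_1], and no quotient by the r-th roots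
    of unity has to be computed. *)
From mathcomp Require Import all_boot all_order all_algebra.
From mathcomp Require Import cyclic separable cyclotomic.
From mathcomp Require Import boolp classical_sets reals complex.
(* Required last: space and restrict would otherwise be those of vector.v. *)
Require Import Defs.
Set Implicit Arguments.
Unset Strict Implicit.
Unset Printing Implicit Defensive.
Import GRing.Theory.
Local Open Scope ring_scope.
Local Open Scope classical_set_scope.

(** * Subvarieties and morphisms *)

Section Spaces.
Variable k : closedFieldType.
Implicit Types (X Y Z : space k) (V W S T : set (vpoint k)).

Lemma morphism_id X : is_space X -> is_morphism X X id.
Proof.
move=> sX; split=> // [V oV|V g rg] /=.
  by apply: (open_setI sX) => //; apply: (open_full sX).
have oV := regular_open sX rg.
apply: (regular_res sX rg) => [|x []//].
by apply: (open_setI sX) => //; apply: (open_full sX).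
Qed.

Lemma isomorphic_refl X : is_space X -> isomorphic X X.
Proof. by move=> sX; exists id, id; split=> //; apply: morphism_id. Qed.

Lemma restrict_incl X S : is_space X -> is_morphism (restrict X S) X id.
Proof.
move=> sX; split=> [x []//|V oV|V g rg] /=.
  exists (X `&` V); first by apply: (open_setI sX) => //; apply: (open_full sX).
  by rewrite setIAC.
have oV := regular_open sX rg; have VX := open_sub sX oV.
have E : X `&` S `&` V = V `&` S.
  by apply/seteqP; split=> x => [[[]]//|[Vx Sx]]; split=> //; split=> //; apply: VX.
rewrite E; split; first by exists V.
by move=> x [Vx Sx]; exists V, g; split.
Qed.

(** Sections of [restrict Y S] are only locally restrictions of sections of [Y], so their pullbacks
    are regular locally and are then glued on [X]. *)
Lemma restrict_corestrict X Y S f : is_space X -> is_morphism X Y f ->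
  (forall x, carrier X x -> S (f x)) -> is_morphism X (restrict Y S) f.
Proof.
move=> sX [sf of_ rf] hS.
have oP V : opens (restrict Y S) V -> opens X (X `&` f @^-1` V).
  move=> [W oW ->]; have := of_ _ oW; congr opens.
  by apply/seteqP; split=> x [Xx Wx]; split=> //=; [split=> //; apply: hS|case: Wx].
split=> // [x Xx|V g [oV hg]]; first by split; [exact: sf|exact: hS].
apply: (regular_glue sX); first exact: oP.
move=> x [Xx /= Vx]; have [W [u [rW Wx gu]]] := hg _ Vx.
have ru := rf _ _ rW.
exists ((X `&` f @^-1` V) `&` (X `&` f @^-1` W)); split=> [||y []//].
  apply: (regular_ext sX) (_ : eq_on _ (u \o f) _).
    apply: (regular_res sX ru) => [|y []//].
    by apply: (open_setI sX); [exact: oP|exact: (regular_open sX ru)].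
  by move=> y [[_ Vy] [_ Wy]] /=; rewrite gu.
by split; split.
Qed.

Lemma isomorphic_restrict X Y f g S T : is_space X -> is_space Y ->
  is_morphism X Y f -> is_morphism Y X g ->
  eq_on X (g \o f) id -> eq_on Y (f \o g) id ->
  (forall x, carrier X x -> S x -> T (f x)) ->
  (forall y, carrier Y y -> T y -> S (g y)) ->
  isomorphic (restrict X S) (restrict Y T).
Proof.
move=> sX sY mf mg gf fg hf hg; exists f, g; split.
- have sR := restrict_is_space S sX.
  apply: restrict_corestrict => //.
    exact: (morphism_comp sR (restrict_incl S sX) mf).
  by move=> x [Xx Sx]; apply: hf.
- have sR := restrict_is_space T sY.
  apply: restrict_corestrict => //.
    exact: (morphism_comp sR (restrict_incl T sY) mg).
  by move=> x [Xx Sx]; apply: hg.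
- by move=> x [Xx _]; apply: gf.
- by move=> x [Xx _]; apply: fg.
Qed.

(** On an open subset the local extensions can be glued inside [X], so the induced structure has no
    new functions. *)
Lemma regular_restrict_open X U V f : is_space X -> opens X U ->
  regular (restrict X U) V f -> regular X V f.
Proof.
move=> sX oU [[W oW VE] h].
have oV : opens X V by rewrite VE; apply: (open_setI sX).
apply: (regular_glue sX) => // x Vx; have [W' [g [rg Wx fg]]] := h x Vx.
exists (V `&` W'); split=> //.
apply: (regular_ext sX) (_ : eq_on _ g _); last by move=> y hy; rewrite fg.
apply: (regular_res sX rg) => [|y []//].
by apply: (open_setI sX) => //; apply: (regular_open sX rg).
Qed.

(** Inverses are not among the axioms of [is_space]. They exist on each chart of the affine cover
    and glue. This is what allows Laurent monomials on an arbitrary variety. *)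
Lemma variety_has_inverses X : is_variety X -> has_inverses X.
Proof.
move=> [sX [N [U [hU XE]]] _] V f rf.
have oV := regular_open sX rf; have VX := open_sub sX oV.
have key x : V x -> f x != 0 -> exists W,
    [/\ regular X W (fun y => (f y)^-1), W x & W `<=` V `&` [set y | f y != 0]].
  move=> Vx fx; have : (X : set _) x := VX _ Vx.
  rewrite XE => -[i _ Ui]; have [oU aU] := hU i.
  have oVU := open_setI sX oV oU.
  have rU : regular (restrict X (U i)) (V `&` U i) f.
    split; first by exists V.
    by move=> y [Vy Uy]; exists V, f; split.
  exists (V `&` U i `&` [set y | f y != 0]); split.
  - by apply: (regular_restrict_open sX oU); apply: is_affine_has_inverses.
  - by [].
  - by move=> y [[]].
apply: (regular_glue sX) => [|x [Vx fx]]; last by apply: key.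
apply: (open_local sX) => x [Vx fx]; have [W [rW Wx sW]] := key x Vx fx.
by exists W; split=> //; apply: (regular_open sX rW).
Qed.

(** Under the isomorphism of [X] with [zeros P], the closed set [S] is cut out by further
    polynomials [Q], so it becomes [zeros (P]|[Q)]. *)
Lemma is_affine_closed X S : is_affine X -> is_closed X S ->
  is_affine (restrict X S).
Proof.
move=> [sX [n [P [f [g [mf mg gf fg]]]]]] [SX oS].
split; first exact: restrict_is_space.
set Y := restrict _ _ in mf mg fg.
have sA := affine_is_space k n.
have sY : is_space Y by apply: restrict_is_space.
(* The preimage of the complement of [S] is the trace on [zeros P] of the complement of some
   [zeros Q]. *)
have [W [Q WE] oE] := mor_open mg oS.
exists n, (P `|` Q).
have -> : zeros (P `|` Q) = zeros P `&` (zeros Q).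
  apply/seteqP; split=> x.
    by move=> [sx hx]; split; split=> // p hp; apply: hx; [left|right].
  by move=> [[sx hx] [_ hy]]; split=> // p [/hx|/hy].
rewrite -restrict_restrict//.
have hY y : carrier Y y -> S (g y) <-> zeros Q y.
  move=> Yy; have /= gX := mor_sub mg Yy; have [sy Py] := Yy.
  have E : (Y `&` g @^-1` (X `\` S)) y =
      ((affine_space k n `\` zeros Q) `&` zeros P) y by rewrite oE WE.
  split=> h; apply: contrapT => hn.
    have : ((affine_space k n `\` zeros Q) `&` zeros P) y by [].
    by rewrite -E => -[_ []].
  have : (Y `&` g @^-1` (X `\` S)) y by [].
  by rewrite E => -[[]].
apply: (isomorphic_restrict sX sY mf mg gf fg).
  by move=> x Xx Sx; apply/hY; [exact: (mor_sub mf)|have /= -> := gf _ Xx].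
by move=> y Yy /hY; apply.
Qed.

(** The traces on [S] of the affine charts of [X] cover [S], and separatedness is inherited by
    composing with the inclusion into [X]. *)
Lemma closed_is_variety X S : is_variety X -> is_closed X S ->
  is_variety (restrict X S).
Proof.
move=> [sX [N [U [hU XE]]] sepX] cS; have [SX oS] := cS.
have sS := restrict_is_space S sX; split=> //.
  exists N, (fun i => U i `&` S); split=> [i|].
    have [oU aU] := hU i; split; first by exists (U i).
    (* The trace of the chart is rewritten as a closed subset of the affine space
       [restrict X (U i)]. *)
    rewrite restrict_restrict// setIC -setIA setIid -[U i]setIid -setIA.
    rewrite -restrict_restrict//; apply: is_affine_closed => //; split.
      by move=> x [Ux Sx]; split=> //; apply: SX.
    exists (X `\` S) => //; apply/seteqP; split=> x /=.
      by move=> [[Xx Ux] nS]; split=> //; split=> // Sx; apply: nS.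
    by move=> [[Xx nS] Ux]; split=> // -[].
  apply/seteqP; split=> x /=.
    by rewrite {1}XE => -[[i _ Ux] Sx]; exists i.
  by move=> [i _ [Ux Sx]]; split=> //; rewrite XE; exists i.
move=> Z f g aZ mf mg; have [sZ _] := aZ.
have mi := restrict_incl S sX.
by apply: sepX => //; [apply: (morphism_comp sZ mf mi)|apply: (morphism_comp sZ mg mi)].
Qed.

Definition closed_subvariety (X : variety k) S (cS : is_closed X S) : variety k :=
  Variety (closed_is_variety (varietyP X) cS).

Lemma variety_is_space (X : variety k) : is_space X.
Proof. by case: (varietyP X). Qed.

Lemma is_closed_restrict X S T : is_space X -> is_closed X S -> T `<=` S ->
  is_closed X T -> is_closed (restrict X S) T.
Proof.
move=> sX [SX oS] TS [TX oT]; split=> [x Tx|].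
  by split; [exact: TX|exact: TS].
exists (X `\` T) => //; apply/seteqP; split=> x /=.
  by move=> [[Xx Sx] nT].
by move=> [[Xx nT] Sx].
Qed.

Lemma is_closedU X S T : is_space X -> is_closed X S -> is_closed X T ->
  is_closed X (S `|` T).
Proof.
move=> sX [SX oS] [TX oT]; split; first by move=> x [/SX|/TX].
have := open_setI sX oS oT; congr opens.
by apply/seteqP; split=> x /=; [move=> [[Xx h] [_ h']]; split=> // -[]|
  move=> [Xx h]; split; split=> // h'; apply: h; [left|right]].
Qed.

Lemma is_closed_set0 X : is_space X -> is_closed X set0.
Proof. by move=> sX; split=> //; rewrite setD0; apply: (open_full sX). Qed.

(** The complement is the domain on which [has_inverses] makes the inverse of [f] regular, hence it
    is open. *)
Lemma is_closed_zeros X f : is_space X -> has_inverses X -> regular X X f ->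
  is_closed X (X `&` [set x | f x = 0]).
Proof.
move=> sX iX rf; split; first by move=> x [].
have := regular_open sX (iX _ _ rf); congr opens.
apply/seteqP; split=> x [Xx /= fx]; split=> //; first by move=> [_ /eqP]; apply/negP.
by apply/eqP => f0; apply: fx.
Qed.

End Spaces.

(** * The Grothendieck ring *)

Section K0.
Variable k : closedFieldType.
Implicit Types X Y Z U P : variety k.

Lemma K0_classD X Z U S : is_closed X S -> isomorphic Z (restrict X S) ->
  isomorphic U (restrict X (X `\` S)) -> K0_class X = K0_class Z + K0_class U.
Proof.
move=> cS hZ hU; rewrite [RHS]paddE.
exact/pclassP/req_rel/(K0_scissor cS hZ hU).
Qed.

Lemma K0_classM P X Y : is_product P X Y -> K0_class P = K0_class X * K0_class Y.
Proof. by move=> h; rewrite [RHS]pmulE; apply/pclassP/req_rel/K0_product. Qed.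

Lemma K0_class_point X : isomorphic X (affine_space k 0) -> K0_class X = 1.
Proof. by move=> h; apply/pclassP/req_rel/K0_point. Qed.

(** Induction on [N]: the last piece is split off by a scissor relation. Its complement is the union
    of the other pieces, hence closed and again a variety. *)
Lemma K0_class_closed_partition X Y N (S : nat -> set (vpoint k)) :
  (forall i, (i < N)%N -> is_closed X (S i)) ->
  (forall i j x, (i < N)%N -> (j < N)%N -> S i x -> S j x -> i = j) ->
  (forall x, carrier X x -> exists2 i, (i < N)%N & S i x) ->
  (forall i, (i < N)%N -> isomorphic Y (restrict X (S i))) ->
  K0_class X = K0_class Y *+ N.
Proof.
elim: N X => [|N IH] X cS dS XS hY; have sX := variety_is_space X.
  (* With no pieces [X] is empty, and cutting along the empty set gives [[X] = [X] + [X]], so [[X] =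
     0]. *)
  have E : (X : set _) = set0.
    by apply/seteqP; split=> x // /XS[].
  have hX : isomorphic X (restrict X set0).
    by rewrite -E restrict_full//; apply: isomorphic_refl.
  have hX' : isomorphic X (restrict X (X `\` set0)).
    by rewrite setD0 restrict_full//; apply: isomorphic_refl.
  apply: (addrI (K0_class X)); rewrite mulr0n addr0.
  by rewrite -(K0_classD (is_closed_set0 sX) hX hX').
have lt_S i : (i < N)%N -> (i < N.+1)%N by move=> /ltnW.
have sSX i : (i < N.+1)%N -> S i `<=` X by move=> /cS[].
have [_ oN] := cS N (ltnSn N).
have cU : is_closed X (X `\` S N).
  have -> : X `\` S N = \bigcup_(i in [set i | (i < N)%N]) S i.
    apply/seteqP; split=> x /=.
      move=> [Xx nN]; have [j] := XS x Xx.
      by rewrite ltnS leq_eqVlt => /orP[/eqP -> //|lt_j Sx]; exists j.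
    move=> [i /= lt_i Sx]; split; first exact: (sSX i (lt_S i lt_i)).
    move=> Nx; have := dS i N x (lt_S i lt_i) (ltnSn N) Sx Nx => E.
    by rewrite E ltnn in lt_i.
  have : forall i, (i < N)%N -> is_closed X (S i) by move=> i /lt_S/cS.
  elim: (N) => [|M IHM] cM.
    have -> : \bigcup_(i in [set i | (i < 0)%N]) S i = set0.
      by apply/seteqP; split=> x // [].
    exact: is_closed_set0.
  have -> : \bigcup_(i in [set i | (i < M.+1)%N]) S i =
      (\bigcup_(i in [set i | (i < M)%N]) S i) `|` S M.
    apply/seteqP; split=> x /=.
      move=> [i /=]; rewrite ltnS leq_eqVlt => /orP[/eqP -> Sx|]; first by right.
      by left; exists i.
    by move=> [[i /= /ltnW lt_i Sx]|Sx]; [exists i|exists M => /=].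
  by apply: is_closedU => //; [apply: IHM => i /ltnW/cM|exact: cM].
rewrite mulrS; pose U := closed_subvariety cU.
rewrite (@K0_classD X Y U (S N) (cS _ (ltnSn N)) (hY _ (ltnSn N))); last first.
  exact/isomorphic_refl/restrict_is_space.
have SU i : (i < N)%N -> S i `<=` X `\` S N.
  move=> lt_i x Sx; split; first exact: (sSX i (lt_S i lt_i)).
  move=> Nx; have := dS i N x (lt_S i lt_i) (ltnSn N) Sx Nx => E.
  by rewrite E ltnn in lt_i.
congr (_ + _); apply: IH => /=.
- by move=> i lt_i; apply: is_closed_restrict => //; [exact: SU|exact/cS/lt_S].
- by move=> i j x /lt_S hi /lt_S hj; apply: dS.
- move=> x [_ [Xx nN]]; have [j] := XS x Xx.
  by rewrite ltnS leq_eqVlt => /orP[/eqP -> //|lt_j Sx]; exists j.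
- move=> i lt_i; rewrite restrict_restrict// setIidr; last exact: SU.
  exact/hY/lt_S.
Qed.

End K0.

(** * Bilinearity of pure tensors *)

Section Tensor.
Variables A B : comPzRingType.

Lemma tensDl (a a' : A) (b : B) : tens (a + a') b = tens a b + tens a' b.
Proof. by rewrite [RHS]paddE; apply/pclassP/req_rel/tensor_addl. Qed.

Lemma tensDr (a : A) (b b' : B) : tens a (b + b') = tens a b + tens a b'.
Proof. by rewrite [RHS]paddE; apply/pclassP/req_rel/tensor_addr. Qed.

Lemma tensM (a a' : A) (b b' : B) : tens a b * tens a' b' = tens (a * a') (b * b').
Proof. by rewrite [LHS]pmulE; apply/pclassP/req_rel/tensor_mul. Qed.

Lemma tens0l (b : B) : tens (0 : A) b = 0.
Proof. by apply/eqP; rewrite -(subrr (tens 0 b)) eq_sym subr_eq -tensDl addr0. Qed.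

Lemma tens0r (a : A) : tens a (0 : B) = 0.
Proof. by apply/eqP; rewrite -(subrr (tens a 0)) eq_sym subr_eq -tensDr addr0. Qed.

Lemma tensMn (a : A) (b : B) n : tens (a *+ n) b = tens a (b *+ n).
Proof.
elim: n => [|n IH]; first by rewrite tens0l tens0r.
by rewrite !mulrS tensDl tensDr IH.
Qed.

End Tensor.

(** * Regular functions *)

Section Regular.
Variable k : closedFieldType.
Variable X : space k.
Hypotheses (sX : is_space X) (iX : has_inverses X).

Lemma regularV f : regular X X f -> (forall x, carrier X x -> f x != 0) ->
  regular X X (fun x => (f x)^-1).
Proof.
move=> rf f0; apply: (regular_res sX (iX rf)); first exact: (open_full sX).
by move=> x Xx; split=> //; apply: f0.
Qed.

Lemma regular_expz f (z : int) : regular X X f ->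
  (forall x, carrier X x -> f x != 0) -> regular X X (fun x => f x ^ z).
Proof.
move=> rf f0; case: z => e; first exact: regularX.
apply: regularV => [|x Xx]; first exact: regularX.
by rewrite expf_neq0// f0.
Qed.

Definition regular_mx a b (F : vpoint k -> 'M[k]_(a, b)) :=
  forall i j, regular X X (fun s => F s i j).

Lemma regular_mxX a (F : vpoint k -> 'M[k]_a) e :
  regular_mx F -> regular_mx (fun s => F s ^+ e).
Proof.
move=> rF; elim: e => [|e IH] i j; first exact/(regular_cst sX)/(open_full sX).
apply: (regular_ext sX) (_ : eq_on X (fun s => \sum_l F s i l * (F s ^+ e) l j) _).
  apply: regular_sum => // [|l]; first exact: (open_full sX).
  exact: (regularM sX).
by move=> x _; rewrite exprS mxE.
Qed.

Lemma regular_det a (F : vpoint k -> 'M[k]_a) :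
  regular_mx F -> regular X X (fun s => \det (F s)).
Proof.
have oX := open_full sX => rF; apply: regular_sum => // s.
apply: (regularM sX); first exact: (regular_cst sX).
by apply: regular_prod => // i; apply: rF.
Qed.

(** The coordinates of a morphism are pullbacks of the coordinate functions of affine space. *)
Lemma regular_morphism_coord n S h i : is_morphism X (restrict (affine_space k n) S) h ->
  (i < n)%N -> regular X X (fun x => (h x)`_i).
Proof.
have sA := affine_is_space k n => mh lt_i.
have mi := morphism_comp sX mh (restrict_incl S sA).
apply: (regular_res sX (mor_regular mi (regular_coord k (Ordinal lt_i)))).
  exact: (open_full sX).
by move=> x Xx; split=> //; apply: (mor_sub mi).
Qed.

Lemma regular_coord_mx r off n (h : vpoint k -> vpoint k) :
  (off + r * r <= n)%N -> (forall i, (i < n)%N -> regular X X (fun x => (h x)`_i)) ->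
  regular_mx (fun s => coord_mx r off (h s)).
Proof.
move=> le_n rh i j.
have := rh (off + (i * r + j))%N.
have -> : (off + (i * r + j) < n)%N.
  apply: leq_trans le_n; rewrite ltn_add2l.
  apply: (@leq_trans (i * r + r)); first by rewrite ltn_add2l.
  by rewrite -mulSnr leq_mul2r ltn_ord orbT.
by move=> /(_ isT) rc; apply: (regular_ext sX rc) => x _; rewrite mxE.
Qed.

End Regular.

(** * The multiplicative group *)

Section Gm.
Variable k : closedFieldType.

Definition Gm_set : set (vpoint k) := [set x | size x = 1%N /\ x`_0 != 0].

Lemma Gm_is_variety : is_variety (restrict (affine_space k 1) Gm_set).
Proof.
apply: (@polyfun_is_variety k 1 unit set0 (fun _ x => x`_0)) => //.
  by move=> _; apply: polyfun_coord.
move=> s; split=> [[ss s0]|[ss _ [_ s0]]]; split=> //.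
Qed.

Definition Gm : variety k := Variety Gm_is_variety.

(** Cut the affine line along its origin, which is isomorphic to the point [affine_space k 0]. *)
Lemma K0_class_Gm : K0_class Gm = lefschetz k - 1.
Proof.
have sA n := affine_is_space k n.
pose L := affine_space k 1.
have rx : regular L L (fun x => x`_0) := regular_coord k (ord0 : 'I_1).
have cS := is_closed_zeros (sA 1%N) (@affine_has_inverses k 1) rx.
set S := _ `&` _ in cS.
apply/eqP; rewrite eq_sym subr_eq addrC; apply/eqP.
rewrite -(@K0_class_point k (affine_variety k 0)); last exact: (isomorphic_refl (sA 0%N)).
apply: (@K0_classD k (affine_variety k 1) _ _ _ cS).
  have -> : variety_space (affine_variety k 0) =
      restrict (affine_space k 0) (affine_space k 0) by rewrite restrict_full.
  have s0 : is_space (restrict (affine_space k 0) (affine_space k 0)).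
    exact/restrict_is_space/sA.
  have sS : is_space (restrict L S) by exact/restrict_is_space/sA.
  (* The only point of [affine_space k 0] is the empty sequence; the origin of the line is
     [[:: 0]]. *)
  exists (fun=> [:: 0]), (fun=> [::]); split.
  - apply: morphism_to_affine => //.
      exact: (restrict_has_inverses (sA _) (@affine_has_inverses k _)).
    by move=> i; apply/(regular_cst s0)/(open_full s0).
  - apply: morphism_to_affine => //.
      exact: (restrict_has_inverses (sA _) (@affine_has_inverses k _)).
    by move=> [].
  - by move=> x [/size0nil ->].
  - by move=> [|a [|b x]] [] //= _ [_ /= ->].
have -> : affine_variety k 1 `\` S = Gm_set.
  apply/seteqP; split=> x /= [sx]; first by move=> nS; split=> //; apply/eqP => x0; apply: nS.
  by move=> /negP x0; split=> // -[_ /= /eqP].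
exact/isomorphic_refl/restrict_is_space/sA.
Qed.

End Gm.

Lemma det_expmx (R : comNzRingType) r (A : 'M[R]_r) e : \det (A ^+ e) = \det A ^+ e.
Proof. by elim: e => [|e IH]; rewrite ?expr0 ?det1// !exprS det_mulmx IH. Qed.

Lemma expmxZ (R : comNzRingType) r (a : R) (A : 'M[R]_r) e :
  (a *: A) ^+ e = a ^+ e *: A ^+ e.
Proof.
elim: e => [|e IH]; first by rewrite !expr0 scale1r.
by rewrite !exprS IH -[LHS]/(_ *m (_ *: _)) -scalemxAl -scalemxAr scalerA.
Qed.

(** * Scaling a pair of matrices *)

Section ScalingPairs.
Variables (k : closedFieldType) (r : nat).
Let d := (r * r + r * r)%N.

(** On encoded pairs this is [(A, B) |-> (a A, b B)]: the first [r * r] coordinates are those of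
    [A]. *)
Definition scale_pair (a b : k) (s : vpoint k) : vpoint k :=
  mkseq (fun i => (if (i < r * r)%N then a else b) * s`_i) d.

Lemma size_scale_pair a b s : size (scale_pair a b s) = d.
Proof. by rewrite size_mkseq. Qed.

Lemma coord_mx_ltn (i j : 'I_r) : (i * r + j < r * r)%N.
Proof.
apply: (@leq_trans (i * r + r)); first by rewrite ltn_add2l.
by rewrite -mulSnr leq_mul2r ltn_ord orbT.
Qed.

Lemma coord_mx_scale_fst a b s :
  coord_mx r 0 (scale_pair a b s) = a *: coord_mx r 0 s.
Proof.
apply/matrixP => i j; have lt_ij := coord_mx_ltn i j.
by rewrite !mxE add0n nth_mkseq ?lt_ij// ltn_addl.
Qed.

Lemma coord_mx_scale_snd a b s :
  coord_mx r (r * r) (scale_pair a b s) = b *: coord_mx r (r * r) s.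
Proof.
apply/matrixP => i j; have lt_ij := coord_mx_ltn i j.
by rewrite !mxE nth_mkseq ?ltn_add2l// ltnNge leq_addr.
Qed.

Lemma scale_pairA a b a' b' s :
  scale_pair a b (scale_pair a' b' s) = scale_pair (a * a') (b * b') s.
Proof.
apply/eq_in_map => i; rewrite mem_iota add0n => /andP[_ lt_i]; rewrite nth_mkseq// mulrA.
by case: ifP.
Qed.

Lemma scale_pair1 s : size s = d -> scale_pair 1 1 s = s.
Proof.
move=> ss; apply: (@eq_from_nth _ 0) => [|i]; rewrite size_scale_pair// => lt_i.
by rewrite nth_mkseq// if_same mul1r.
Qed.

(** The scalars may vary with the point, so that this covers both constant roots of unity and powers
    of the coordinate of [Gm]. *)
Lemma scale_pair_morphism (X : space k) T (a b : vpoint k -> k) f :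
  is_space X -> has_inverses X -> regular X X a -> regular X X b ->
  (forall i, (i < d)%N -> regular X X (fun x => (f x)`_i)) ->
  (forall x, carrier X x -> T (scale_pair (a x) (b x) (f x))) ->
  is_morphism X (restrict (affine_space k d) T) (fun x => scale_pair (a x) (b x) (f x)).
Proof.
move=> sX iX ra rb rf hT; apply: morphism_to_affine => // [x Xx|i].
  by rewrite size_scale_pair; split=> //; apply: hT.
apply: (regular_ext sX) (_ : eq_on X
  (fun x => (if (i < r * r)%N then a x else b x) * (f x)`_i) _).
  by apply: (regularM sX); [case: (i < r * r)%N|apply: rf].
by move=> x _; rewrite nth_mkseq.
Qed.

End ScalingPairs.

(** * Schur's lemma and scaling of irreducible pairs *)

Section Irreducible.
Variable k : closedFieldType.

Lemma stablemxZ r (a : k) (W A : 'M[k]_r) : a != 0 ->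
  stablemx W (a *: A) = stablemx W A.
Proof. by move=> a0; rewrite -scalemxAr (eqmx_scale _ a0). Qed.

Lemma row_irreducibleZ r (a b : k) (A B : 'M[k]_r) : a != 0 -> b != 0 ->
  row_irreducible A B -> row_irreducible (a *: A) (b *: B).
Proof. by move=> a0 b0 irr W; rewrite !stablemxZ//; apply: irr. Qed.

(** Over an algebraically closed field [M] has an eigenvalue. Its eigenspace is nonzero and stable
    under [A] and [B], hence everything. *)
Lemma row_irreducible_schur r (A B M : 'M[k]_r) : (0 < r)%N ->
  row_irreducible A B -> comm_mx M A -> comm_mx M B -> exists c, M = c%:M.
Proof.
move=> r0 irr cA cB.
have : size (char_poly M) != 1%N by rewrite size_char_poly; case: (r) r0.
move=> /closed_rootP[c]; rewrite -eigenvalue_root_char => ev; exists c.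
have [W0|fW] : eigenspace M c = 0 \/ row_full (eigenspace M c).
- by apply: irr; apply: comm_mx_stable_eigenspace.
- by move: ev; rewrite /eigenvalue W0 eqxx.
- by move: fW; rewrite -sub1mx => /eigenspaceP; rewrite mul1mx scalemx1.
Qed.

(** The matrix [A ^+ n] commutes with [A], and, being equal to [B ^+ m], also with [B]. Transposes
    translate between the action on columns and stable row spaces. *)
Lemma irr_rep_schur G n m r (s : vpoint k) : irr_rep_set G n m r s ->
  exists c, coord_mx r 0 s ^+ n = c%:M.
Proof.
move=> [[_ [/in_group_unit uA /in_group_unit uB AB]]] /(irreducible_repP uA uB)[r0 irr].
set A := coord_mx r 0 s in uA AB irr *; set B := coord_mx r (r * r) s in uB AB irr.
have [||c E] := @row_irreducible_schur r _ _ (A ^+ n)^T r0 irr.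
- rewrite /comm_mx -!trmx_mul; congr trmx.
  exact: (commrX n (commr_refl A)).
- rewrite /comm_mx -!trmx_mul AB; congr trmx.
  exact: (commrX m (commr_refl B)).
by exists c; rewrite -[LHS]trmxK E tr_scalar_mx.
Qed.

(** Nonzero scalars do not change the stable subspaces, and [a ^+ n = b ^+ m] preserves the
    relation. The two groups may differ, for passing between [SL] and [GL]. *)
Lemma irr_rep_scale G G' n m r (a b : k) (s : vpoint k) : a != 0 -> b != 0 -> a ^+ n = b ^+ m ->
  in_group G' (a *: coord_mx r 0 s) -> in_group G' (b *: coord_mx r (r * r) s) ->
  irr_rep_set G n m r s -> irr_rep_set G' n m r (scale_pair r a b s).
Proof.
move=> a0 b0 ab gA gB [[_ [/in_group_unit uA /in_group_unit uB AB]]] irr.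
have uaA := in_group_unit gA; have ubB := in_group_unit gB.
split; first split; rewrite ?size_scale_pair//=.
  by rewrite coord_mx_scale_fst coord_mx_scale_snd !expmxZ ab AB.
rewrite /= coord_mx_scale_fst coord_mx_scale_snd.
apply/(irreducible_repP uaA ubB); move: irr => /(irreducible_repP uA uB)[r0 irr].
by split=> //; rewrite !linearZ; apply: row_irreducibleZ.
Qed.

(** The locus [c = w] of the [SL] variety; [w = 1] gives the set R_1. *)
Definition irr_component n m r (w : k) : set (vpoint k) :=
  irr_rep_set SL n m r `&` [set s | coord_mx r 0 s ^+ n = w%:M].

Lemma scale_component n m r (a b w : k) s : a != 0 -> b != 0 -> a ^+ n = b ^+ m ->
  a ^+ r = 1 -> b ^+ r = 1 -> irr_component n m r w s ->
  irr_component n m r (a ^+ n * w) (scale_pair r a b s).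
Proof.
move=> a0 b0 ab ar br [irr /= An]; split; last first.
  by rewrite /= coord_mx_scale_fst expmxZ An scale_scalar_mx.
have [[_ [/= dA dB _]] _] := irr.
by apply: irr_rep_scale irr; rewrite //= detZ ?dA ?dB mulr1.
Qed.

Lemma component_isomorphic n m r (a b w : k) : a != 0 -> b != 0 -> a ^+ n = b ^+ m ->
  a ^+ r = 1 -> b ^+ r = 1 ->
  isomorphic (restrict (affine_space k (r * r + r * r)) (irr_component n m r w))
    (restrict (affine_space k (r * r + r * r)) (irr_component n m r (a ^+ n * w))).
Proof.
have sA := affine_is_space k (r * r + r * r).
have mor (a' b' w' : k) : a' != 0 -> b' != 0 -> a' ^+ n = b' ^+ m ->
    a' ^+ r = 1 -> b' ^+ r = 1 ->
    is_morphism (restrict (affine_space k (r * r + r * r)) (irr_component n m r w'))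
      (restrict (affine_space k (r * r + r * r)) (irr_component n m r (a' ^+ n * w')))
      (scale_pair r a' b').
  move=> a0 b0 ab ar br; set Y := restrict _ (irr_component _ _ _ w').
  have sY : is_space Y by exact: restrict_is_space.
  have iY : has_inverses Y by exact/restrict_has_inverses/affine_has_inverses.
  apply: (scale_pair_morphism sY iY (a := fun=> a') (b := fun=> b') (f := id)).
  - exact/(regular_cst sY)/(open_full sY).
  - exact/(regular_cst sY)/(open_full sY).
  - by move=> i; apply: (regular_morphism_coord sY (morphism_id sY)).
  - by move=> x [_]; apply: scale_component.
move=> a0 b0 ab ar br; exists (scale_pair r a b), (scale_pair r a^-1 b^-1); split.
- exact: mor.
- have := mor a^-1 b^-1 (a ^+ n * w); rewrite exprVn mulKf ?expf_neq0//.
  by apply; rewrite ?invr_eq0// !exprVn ?ab ?ar ?br ?invr1.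
- by move=> x [sx _] /=; rewrite scale_pairA !mulVf// scale_pair1.
- by move=> x [sx _] /=; rewrite scale_pairA !mulfV// scale_pair1.
Qed.

End Irreducible.

(** * The two decompositions *)

Section Bezout.
Variables (F : fieldType) (p q : nat) (u v : int).
Hypothesis uv : u * p%:Z + v * q%:Z = 1.

(** If [x = t ^+ p] and [y = t ^+ q], Bezout forces [t = x ^ u * y ^ v]. Conversely,
    [x ^+ q = y ^+ p] turns [y ^ (v * p)] into [x ^ (v * q)], and the exponents of [x] add up to
    1. *)
Lemma bezout_root (x y : F) : x != 0 -> y != 0 -> x ^+ q = y ^+ p ->
  (x ^ u * y ^ v) ^+ p = x /\ (x ^ u * y ^ v) ^+ q = y.
Proof.
move=> x0 y0; rewrite !exprnP => xy; rewrite !expfzMl !exprz_exp.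
split.
  by rewrite [v * _]mulrC -[y ^ _]exprz_exp -xy exprz_exp -expfzDr// [_ * v]mulrC uv.
by rewrite [u * _]mulrC -[x ^ _]exprz_exp xy exprz_exp -expfzDr// [_ * u]mulrC uv.
Qed.

Lemma bezout_rootK (l : F) : l != 0 -> (l ^+ p) ^ u * (l ^+ q) ^ v = l.
Proof.
move=> l0; rewrite !exprnP !exprz_exp -expfzDr//.
by rewrite [_ * u]mulrC [_ * v]mulrC uv.
Qed.

End Bezout.

Lemma bezout_coprime p q : coprime p q -> exists u v : int, u * p%:Z + v * q%:Z = 1.
Proof.
move=> co; have [u [v E]] := Bezoutz p q; exists u, v.
by rewrite E; move: co; rewrite /coprime /gcdz /= => /eqP ->.
Qed.

(** * The decomposition of the SL variety by the value of [c] *)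

Section Components.
Variables (k : closedFieldType) (n m r : nat).
Let d := (r * r + r * r)%N.
Let A := coord_mx r 0 : vpoint k -> 'M[k]_r.
Let B := coord_mx r (r * r) : vpoint k -> 'M[k]_r.

Lemma regular_irr_rep_mx G :
  regular_mx (irr_rep_variety k G n m r) A /\ regular_mx (irr_rep_variety k G n m r) B.
Proof.
have sX := variety_is_space (irr_rep_variety k G n m r).
have rc i := @regular_morphism_coord _ _ sX d _ id i (morphism_id sX).
by split; apply: (regular_coord_mx sX (n := d) _ rc); rewrite /d ?leq_addl.
Qed.

(** By Schur's lemma [A ^+ n] is scalar, so the single equation on its first diagonal entry cuts out
    the component. *)
Lemma irr_component_closed w : (0 < r)%N ->
  is_closed (irr_rep_variety k SL n m r) (irr_component n m r w).
Proof.
move=> r_gt0; set X := irr_rep_variety _ _ _ _ _; pose i0 := Ordinal r_gt0.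
have sX := variety_is_space X; have iX := variety_has_inverses (varietyP X).
have rA := (regular_irr_rep_mx SL).1.
have rf : regular X X (fun s => (A s ^+ n) i0 i0 + - w).
  apply: (regularD sX); first exact: regular_mxX.
  exact/(regular_cst sX)/(open_full sX).
suff <- : X `&` [set s | (A s ^+ n) i0 i0 + - w = 0] = irr_component n m r w.
  exact: is_closed_zeros.
apply/seteqP; split=> s.
  move=> [[_ irr] /= /eqP]; rewrite subr_eq0 => /eqP E; split=> //=.
  by have [c Ec] := irr_rep_schur irr; rewrite Ec -E /A Ec mxE eqxx mulr1n.
move=> [irr /= Aw]; split; last by rewrite /= /A Aw mxE eqxx mulr1n subrr.
by split=> //; case: irr => -[].
Qed.

Lemma restrict_irr_component w :
  restrict (irr_rep_variety k SL n m r) (irr_component n m r w) =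
  restrict (affine_space k d) (irr_component n m r w).
Proof.
rewrite /= restrict_restrict; last exact: affine_is_space.
by congr restrict; apply: setIidr => s [].
Qed.

Lemma irr_component_is_variety w : (0 < r)%N ->
  is_variety (restrict (affine_space k d) (irr_component n m r w)).
Proof.
move=> r_gt0; rewrite -restrict_irr_component; apply: closed_is_variety.
  exact: varietyP.
exact: irr_component_closed.
Qed.

Definition irr_component_variety (r_gt0 : (0 < r)%N) w : variety k :=
  Variety (irr_component_is_variety w r_gt0).

(* As x |-> x^(mn) is a bijection of the r-th roots of unity, the scalars
   zeta^(mnj), j < r, are all the possible values of A^n = B^m on SL_r. *)
Lemma K0_class_irr_SL (z : k) (r_gt0 : (0 < r)%N) :
  coprime r n -> coprime r m -> r.-primitive_root z ->
  K0_class (irr_rep_variety k SL n m r) =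
    K0_class (irr_component_variety r_gt0 1) *+ r.
Proof.
move=> co_rn co_rm zP.
have wP : r.-primitive_root (z ^+ (m * n)).
  by rewrite (prim_root_exp_coprime _ zP) coprime_sym coprimeMr co_rm.
have zU : z != 0.
  apply/eqP => z0; have := prim_expr_order zP.
  by rewrite z0 expr0n gtn_eqF// => /eqP; rewrite eq_sym oner_eq0.
set w := z ^+ (m * n) in wP.
apply: (K0_class_closed_partition (S := fun j => irr_component n m r (w ^+ j))).
- by move=> j _; apply: irr_component_closed.
- move=> i j s lt_i lt_j [_ /= Ei] [_ /= Ej]; move: Ei; rewrite Ej.
  move=> /matrixP/(_ (Ordinal r_gt0) (Ordinal r_gt0)); rewrite !mxE eqxx !mulr1n.
  move/eqP; rewrite (eq_prim_root_expr wP) => /eqP.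
  by rewrite !modn_small.
- move=> s [_ irr]; have [c Ec] := irr_rep_schur irr.
  have [[_ [/= dA _ _]] _] := irr.
  (* Take determinants in [A ^+ n = c%:M], where [\det A = 1]. *)
  have /(prim_rootP wP)[j cj] : c ^+ r = 1.
    by rewrite -det_scalar -Ec det_expmx dA expr1n.
  by exists j => //; split=> //=; rewrite Ec cj.
- move=> j _; rewrite restrict_irr_component.
  (* Scaling by [a = z ^+ (m * j)] and [b = z ^+ (n * j)] carries the component of 1 to that of
     [a ^+ n = b ^+ m = w ^+ j]. *)
  have -> : w ^+ j = (z ^+ (m * j)) ^+ n * 1.
    by rewrite mulr1 /w -!exprM mulnAC.
  have zr e : (z ^+ e) ^+ r = 1.
    by rewrite -exprM mulnC exprM (prim_expr_order zP) expr1n.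
  apply: (component_isomorphic (b := z ^+ (n * j))); rewrite ?expf_neq0//.
  by rewrite -!exprM mulnAC [(m * n)%N]mulnC mulnAC.
Qed.

End Components.

(** * The GL variety as a product with the multiplicative group *)

Section Product.
Variables (k : closedFieldType) (n m r : nat).
Hypotheses (r_gt0 : (0 < r)%N) (co_nm : coprime n m).
Hypotheses (co_rn : coprime r n) (co_rm : coprime r m).
Let d := (r * r + r * r)%N.
Let A := coord_mx r 0 : vpoint k -> 'M[k]_r.
Let B := coord_mx r (r * r) : vpoint k -> 'M[k]_r.

(* With A^n = B^m = c, Bezout gives a unique t with t^m = det A and t^n = det B,
   and then a unique l with l^r = t and l^(mn) = c. *)
Lemma irr_GL_product :
  is_product (irr_rep_variety k GL n m r) (irr_component_variety n m r_gt0 1) (Gm k).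
Proof.
have co_mn : coprime m n by rewrite coprime_sym.
have [u [v uv]] := bezout_coprime co_mn.
have [e [f ef]] : exists e f : int, e * r%:Z + f * (m * n)%N%:Z = 1.
  by apply: bezout_coprime; rewrite coprimeMr co_rm.
pose i0 := Ordinal r_gt0.
(* The scalar [c] is read off a diagonal entry, so that it is visibly regular. *)
pose c s := (A s ^+ n) i0 i0.
(* The inner product is [t]; then [l] is obtained from [t] and [c] by the second Bezout identity. *)
pose l s := (\det (A s) ^ u * \det (B s) ^ v) ^ e * c s ^ f.
set X := irr_rep_variety k GL n m r.
have sX := variety_is_space X; have iX := variety_has_inverses (varietyP X).
have [rA rB] := regular_irr_rep_mx k n m r GL.
have detP s : irr_rep_set GL n m r s ->
    [/\ \det (A s) != 0, \det (B s) != 0, c s != 0 & A s ^+ n = (c s)%:M].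
  move=> irr; have [[_ [/= uA uB _]] _] := irr.
  have [a Ea] := irr_rep_schur irr.
  have ca : c s = a by rewrite /c /A Ea mxE eqxx mulr1n.
  have dA : \det (A s) != 0 by rewrite -unitfE -unitmxE.
  rewrite ca -Ea; split=> //; first by rewrite -unitfE -unitmxE.
  have : a ^+ r != 0 by rewrite -det_scalar -Ea det_expmx expf_neq0.
  by rewrite expf_eq0 r_gt0.
have lP s : irr_rep_set GL n m r s -> [/\ l s != 0, l s ^+ (m * r) = \det (A s),
    l s ^+ (n * r) = \det (B s) & l s ^+ (m * n) = c s].
  move=> irr; have [dA dB c0 Ac] := detP s irr; have [[_ [_ _ AB]] _] := irr.
  have dAB : \det (A s) ^+ n = \det (B s) ^+ m by rewrite -!det_expmx [_ ^+ n]AB.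
  have [tm tn] := bezout_root uv dA dB dAB.
  set t := \det (A s) ^ u * \det (B s) ^ v in tm tn.
  have t0 : t != 0 by rewrite mulf_neq0// expfz_neq0.
  (* Both sides are the determinant of [A ^+ n]. This is the compatibility needed to apply
     [bezout_root] to [t] and [c]. *)
  have tc : t ^+ (m * n) = c s ^+ r.
    by rewrite exprM tm -det_expmx Ac det_scalar.
  have [lr lmn] := bezout_root ef t0 c0 tc.
  rewrite -/(l s) in lr lmn; rewrite ![(_ * r)%N]mulnC !(exprM _ r) lr tm tn.
  by split=> //; rewrite mulf_neq0// expfz_neq0.
have cE s w : irr_component n m r w s ->
    [/\ \det (A s) = 1, \det (B s) = 1 & c s = w].
  move=> [[[_ [/= dA dB _]] _] /= Aw]; split=> //.
  by rewrite /c /A Aw mxE eqxx mulr1n.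
have rl : regular X X l.
  have Xirr x : carrier X x -> irr_rep_set GL n m r x by case.
  apply: (regularM sX); last first.
    apply: regular_expz => // [|x /Xirr/detP[]//].
    exact: regular_mxX.
  apply: regular_expz => // [|x /Xirr/detP[dA dB _ _]]; last first.
    by rewrite mulf_neq0// expfz_neq0.
  apply: (regularM sX).
    by apply: regular_expz => // [|x /Xirr/detP[]//]; apply: regular_det.
  by apply: regular_expz => // [|x /Xirr/detP[]//]; apply: regular_det.
(* The multiplication map; [p1] below divides the scalars out again, and [l] recovers the coordinate
   of [Gm]. *)
pose phi (x y : vpoint k) := scale_pair r (y`_0 ^+ m) (y`_0 ^+ n) x.
have phiP x y : irr_component n m r 1 x -> y`_0 != 0 -> irr_rep_set GL n m r (phi x y).
  move=> [irr _] y0; have [[_ [/in_group_unit uA /in_group_unit uB _]] _] := irr.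
  apply: irr_rep_scale irr; rewrite ?expf_neq0//= ?unitmxZ ?unitfE ?expf_neq0//.
  by rewrite -!exprM mulnC.
have lphi x y : irr_component n m r 1 x -> y`_0 != 0 -> l (phi x y) = y`_0.
  move=> hx y0; have [dA dB c1] := cE _ _ hx.
  rewrite /l /c /A /B coord_mx_scale_fst coord_mx_scale_snd !detZ expmxZ.
  rewrite -/(A x) -/(B x) dA dB mxE -/(c x) c1 !mulr1 -!exprM.
  by rewrite ![(_ * r)%N]mulnC !(exprM _ r) bezout_rootK ?expf_neq0// bezout_rootK.
pose p1 s := scale_pair r (l s ^+ m)^-1 (l s ^+ n)^-1 s.
exists p1, (fun s => [:: l s]).
have p1P s : irr_rep_set GL n m r s -> irr_component n m r 1 (p1 s).
  move=> irr; have [l0 lA lB lc] := lP s irr; have [_ _ _ Ac] := detP s irr.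
  split; last first.
    rewrite /= /p1 coord_mx_scale_fst expmxZ [_ ^+ n in X in _ *: X]Ac.
    by rewrite scale_scalar_mx exprVn -exprM lc mulVf// -lc expf_neq0.
  apply: irr_rep_scale irr; rewrite /= ?invr_eq0 ?expf_neq0//.
  - by rewrite !exprVn -!exprM mulnC.
  - by rewrite detZ -/(A s) -lA exprVn -exprM mulVf// expf_neq0.
  - by rewrite detZ -/(B s) -lB exprVn -exprM mulVf// expf_neq0.
have phiK s : irr_rep_set GL n m r s -> phi (p1 s) [:: l s] = s.
  move=> irr; have [l0 _ _ _] := lP s irr.
  rewrite /phi /p1 scale_pairA /= !mulfV ?expf_neq0// scale_pair1//.
  by case: irr => -[].
split.
- apply: scale_pair_morphism => //.
  + apply: regularV => // [|x [_ /lP[l0 _ _ _]]]; first exact: regularX.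
    by rewrite expf_neq0.
  + apply: regularV => // [|x [_ /lP[l0 _ _ _]]]; first exact: regularX.
    by rewrite expf_neq0.
  + by move=> i; apply: (regular_morphism_coord sX (morphism_id sX)).
  + by move=> x [_ irr]; apply: p1P.
- apply: morphism_to_affine => // [x [_ /lP[l0 _ _ _]]|i]; first by [].
  by rewrite ord1.
(* Uniqueness holds because [phiK] recovers a point from its two projections; existence is given by
   composing [phi] with [g] and [h]. *)
move=> Z g h mg mh; split; last first.
  move=> g' h' mg' mh' E1 E2 z Zz.
  have [_ irr1] := mor_sub mg' Zz; have [_ irr2] := mor_sub mh' Zz.
  rewrite -(phiK _ irr1) -(phiK _ irr2).
  by have /= -> := E1 z Zz; have /= -> := E2 z Zz.
have sZ := variety_is_space Z; have iZ := variety_has_inverses (varietyP Z).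
have rh := regular_morphism_coord sZ mh (ltn0Sn 0).
have gP z : carrier Z z -> irr_component n m r 1 (g z) by move=> /(mor_sub mg)[].
have hP z : carrier Z z -> Gm_set (h z) by move=> /(mor_sub mh)[].
exists (fun z => phi (g z) (h z)); split.
- apply: scale_pair_morphism => //.
  + exact: regularX.
  + exact: regularX.
  + by move=> i; apply: (regular_morphism_coord sZ mg).
  + by move=> z Zz; apply: phiP; [exact: gP|have [] := hP z Zz].
- move=> z Zz /=; have [_ h0] := hP z Zz.
  rewrite /p1 lphi//; last exact: gP.
  rewrite scale_pairA !mulVf ?expf_neq0// scale_pair1//.
  by have [[[]]] := gP z Zz.
- move=> z Zz /=; have [sh h0] := hP z Zz; rewrite lphi//; last exact: gP.
  by case: (h z) sh => [|a []].
Qed.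

End Product.

(** * Primitive roots of unity and the comparison of classes *)

Lemma prim_root_exists (F : closedFieldType) r : (r%:R : F) != 0 ->
  exists z : F, r.-primitive_root z.
Proof.
move=> r0; have r_gt0 : (0 < r)%N by rewrite lt0n; apply: contraNneq r0 => ->.
(* This polynomial splits, and is separable because [r] is nonzero in [F]. It thus has [r] distinct
   roots, which forces a primitive one. *)
have [rs] := closed_field_poly_normal ('X^r - 1 : {poly F}).
rewrite (monicP (monicXnsubC _ r_gt0)) scale1r => E.
have rs_root : all r.-unity_root rs.
  by apply/allP => z; rewrite -root_prod_XsubC -E.
have rs_size : (r < (size rs).+1)%N.
  by rewrite -(size_prod_XsubC rs id) -E size_XnsubC.
have rs_uniq : uniq rs.
  by rewrite -separable_prod_XsubC -E separable_Xn_sub_1.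
by have /hasP[z _ zP] := has_prim_root r_gt0 rs_root rs_uniq rs_size; exists z.
Qed.

Theorem theorem1p2 (R : realType) (n m r : nat)
    (n_gt0 : (0 < n)%N) (m_gt0 : (0 < m)%N) (r_gt0 : (0 < r)%N)
    (co_nm : coprime n m) (co_rn : coprime r n) (co_rm : coprime r m) :
  let q : K0 R[i] := lefschetz R[i] in
  let irrGL : K0 R[i] := K0_class (irr_rep_variety R[i] GL n m r) in
  let irrSL : K0 R[i] := K0_class (irr_rep_variety R[i] SL n m r) in
  (tens irrGL 1 : tensor (K0 R[i]) rat) =
    tens (q - 1) (r%:R^-1) * tens irrSL 1.
Proof.
move=> q irrGL irrSL.
have [z zP] : exists z : R[i], r.-primitive_root z.
  by apply: prim_root_exists; rewrite Num.Theory.pnatr_eq0 -lt0n.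
rewrite /irrGL /irrSL (K0_classM (irr_GL_product _ r_gt0 co_nm co_rn co_rm)).
rewrite (K0_class_irr_SL r_gt0 co_rn co_rm zP) K0_class_Gm tensM.
(* The multiplicity [r] of R_1 in the SL class moves across the tensor and cancels the rational
   factor [r%:R^-1]. *)
rewrite mulrnAr tensMn mulr1 -[_^-1 *+ r]mulr_natr mulVf; last first.
  by rewrite Num.Theory.pnatr_eq0 -lt0n.
by rewrite mulrC.
Qed.
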